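(* Let $\Omega_e\subset\mathbb{R}^{N_d}$ be a (possibly curved) element of arbitrary shape and dimension, with DG solution $U_e$ and exterior traces $U_e^-$ on $\partial\Omega_e$. Let $$\overline U_e^{\Delta t}=\overline U_e-\Delta t\sum_{k=1}^{N_\partial}\sum_{q=1}^{N_{q,k}^\partial}\zeta_{k,q}\,\widehat F\big(U_e^+(r(g_{k,q})),U_e^-(r(g_{k,q})),\hat n(g_{k,q})\big)$$ be the element average after one forward Euler step of size $\Delta t>0$, where $\widehat F$ is the local Lax--Friedrichs flux with dissipation coefficient $\lambda$ such that $$\lambda\ge\max\{\nu(U)\;:\;U\in\{U_e^{\pm}(r(g_{k,q}))\}_{k,q}\}\quad\text{and}\quad\lambda\ge\lambda^*.$$ Suppose that real numbers $\theta_{k,q}$ satisfy $\theta_{k,q}>0$ for all $k=1,\dots,N_\partial$, $q=1,\dots,N_{q,k}^\partial$, and $$\theta_v:=\frac{|\mathcal J(r_v)|\,w_v}{V_e}-\sum_{k=1}^{N_\partial}\sum_{q=1}^{N_{q,k}^\partial}\theta_{k,q}\,\phi_v(r(g_{k,q}))\ \ge 0\qquad\text{for all }v=1,\dots,N_q.$$ If $$\Delta t\,\lambda\le\frac12\min_{k,q}\left\{\frac{\theta_{k,q}}{\zeta_{k,q}}\right\},$$ then $$s(\overline U_e^{\Delta t})\ \ge\ s_e^0(t):=\min\{s(U(y))\;:\;y\in\Omega_e\cup\partial\Omega_e^-\}.$$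
   Context: Euler equations in $\mathbb{R}^{N_d}$: states $U=(\rho,\rho u,\rho e)^T$ with velocity $u\in\mathbb{R}^{N_d}$, flux in direction $\hat n$: $F(U)\cdot\hat n=(\rho\,u\cdot\hat n,\ \rho u(u\cdot\hat n)+p\hat n,\ (u\cdot\hat n)(\rho e+p))^T$, pressure $p=(\gamma-1)(\rho e-\tfrac12\rho|u|^2)$, constant $\gamma=1.4$. Sound speed $c=\sqrt{\gamma p/\rho}$, maximum characteristic speed $\nu(U)=|u|+c$, entropy $s(U)=\ln p-\gamma\ln\rho+s_0$ with a fixed constant $s_0$ (defined for states with $\rho>0$, $p>0$). All solution values at time $t$ (in $\Omega_e$ and the exterior traces) have $\rho>0$, $p>0$. Local Lax--Friedrichs flux with dissipation coefficient $\lambda$: $\widehat F(U_L,U_R,\hat n)=\tfrac12(F(U_L)+F(U_R))\cdot\hat n-\tfrac12\lambda(U_R-U_L)$. Geometry and quadrature: $\Omega_e$ is the image of a reference element $\Omega_e^{\rm r}$ under a map $x=\Phi(r)$ with Jacobian $\mathcal J=[\partial x/\partial r]$ ($|\mathcal J|$ its determinant in absolute value); $V_e$ is the volume of $\Omega_e$. $r_v$, $w_v>0$ ($v=1,\dots,N_q$) are volume quadrature points and weights on $\Omega_e^{\rm r}$. The boundary consists of $N_\partial$ faces; the $k$th face is parameterized by $g_k\in\mathbb{R}^{N_d-1}$, with surface quadrature points $g_{k,q}$ and weights $w_{k,q}>0$ ($q=1,\dots,N_{q,k}^\partial$); $r(g_{k,q})$ is the corresponding point of $\partial\Omega_e^{\rm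 r}$, $\mathcal J_k^\partial$ is the surface Jacobian (normal) vector of the face parameterization, and $\hat n=\mathcal J_k^\partial/|\mathcal J_k^\partial|$ is the outward unit normal. Quadrature is taken to be exact for the integrals involved; in particular the element average is $\overline U_e=\sum_{v=1}^{N_q}\frac{|\mathcal J(r_v)|w_v}{V_e}U_e(r_v)$. Set $\zeta_{k,q}=|\mathcal J_k^\partial(g_{k,q})|\,w_{k,q}/V_e>0$; since $\Omega_e$ has a closed surface, $\sum_{k,q}\zeta_{k,q}\hat n(g_{k,q})=0$. $U_e$ lies (componentwise) in an $N_p$-dimensional space of polynomials in $r$, $N_q\ge N_p$. The functions $\phi_v$ are Lagrange interpolation basis functions of this space at $N_p$ points chosen among the $r_v$ (with non-singular interpolation matrix), $\phi_v\equiv0$ for points not chosen; thus $U_e(r)=\sum_{v=1}^{N_q}U_e(r_v)\phi_v(r)$. $U_e^+$ and $U_e^-$ denote interior and exterior traces on $\partial\Omega_e$; $\partial\Omega_e^-$ is the exterior side of the boundary, so $U(y)$ for $y\in\partial\Omega_e^-$ means the exterior trace value. Finally $$\lambda^*=\tau\max_{k,q}\nu\big(U_e^+(r(g_{k,q}))\big),\qquad\tau=\max\big\{\sqrt{N_d},\ \sqrt{2+\gamma(\gamma-1)}\big\}.$$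
   Formalization: The polynomial space containing the components of U_e is assumed to contain the constants, as in any DG scheme; without this the interpolation weights need not sum to one and the stated bound can fail. *)

(* Defs.v *)
From HB Require Import structures.
From mathcomp Require Import all_boot all_order all_algebra.
From mathcomp Require Import all_classical all_reals all_analysis.
(* The notations of mpoly clash with those of mathcomp-analysis. *)
From mathcomp Require mpoly.
Export -(notations) mpoly.
Export numFieldNormedType.Exports.
Export Order.TTheory GRing.Theory Num.Theory.

Set Implicit Arguments.
Unset Strict Implicit.
Unset Printing Implicit Defensive.

Global Open Scope classical_set_scope.
Global Open Scope ring_scope.

Definition dotv (R : realType) (n : nat) (u v : 'rV[R]_n) : R :=
  \sum_i u 0 i * v 0 i.

(* Euclidean norm: the library norm of 'rV[R]_n is the sup norm. *)
Definition norm2 (R : realType) (n : nat) (u : 'rV[R]_n) : R :=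
  Num.sqrt (dotv u u).

(** ** Euler equations in dimension N *)

(* A state (rho, rho u, rho e). *)
Definition state (R : realType) (N : nat) := 'rV[R]_(1 + (N + 1)).

Definition mk_state (R : realType) (N : nat)
    (rho : R) (m : 'rV[R]_N) (E : R) : state R N :=
  row_mx rho%:M (row_mx m E%:M).

Definition density (R : realType) (N : nat) (U : state R N) : R :=
  lsubmx U 0 0.

Definition momentum (R : realType) (N : nat) (U : state R N) : 'rV[R]_N :=
  lsubmx (rsubmx U).

(* Total energy per unit volume, rho e. *)
Definition energy (R : realType) (N : nat) (U : state R N) : R :=
  rsubmx (rsubmx U) 0 0.

Definition velocity (R : realType) (N : nat) (U : state R N) : 'rV[R]_N :=
  (density U)^-1 *: momentum U.

Definition gamma (R : realType) : R := 14 / 10.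

Definition pressure (R : realType) (N : nat) (U : state R N) : R :=
  (gamma R - 1) * (energy U - 2^-1 * density U * norm2 (velocity U) ^+ 2).

Definition admissible (R : realType) (N : nat) (U : state R N) : Prop :=
  0 < density U /\ 0 < pressure U.

Definition sound_speed (R : realType) (N : nat) (U : state R N) : R :=
  Num.sqrt (gamma R * pressure U / density U).

Definition char_speed (R : realType) (N : nat) (U : state R N) : R :=
  norm2 (velocity U) + sound_speed U.

(* Only meaningful on admissible states, since ln is 0 on nonpositive reals. *)
Definition entropy (R : realType) (N : nat) (s0 : R) (U : state R N) : R :=
  ln (pressure U) - gamma R * ln (density U) + s0.

Definition flux (R : realType) (N : nat) (U : state R N) (n : 'rV[R]_N) :
    state R N :=
  let un := dotv (velocity U) n in
  mk_state (density U * un)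
           (un *: momentum U + pressure U *: n)
           (un * (energy U + pressure U)).

Definition llf_flux (R : realType) (N : nat) (lambda : R)
    (UL UR : state R N) (n : 'rV[R]_N) : state R N :=
  2^-1 *: (flux UL n + flux UR n) - (2^-1 * lambda) *: (UR - UL).

(** ** Geometry *)

(* N-dimensional Lebesgue measure, by iterated integration over slices. *)
Fixpoint volume (R : realType) (n : nat) : set 'rV[R]_n -> \bar R :=
  match n return set 'rV[R]_n -> \bar R with
  | 0%N => fun A => (\1_A 0)%:E
  | m.+1 => fun A => (\int[@lebesgue_measure R]_x
      volume [set y : 'rV[R]_m | A (row_mx x%:M y)])%E
  end.

(* Generalized cross product of the tangent vectors of the parameterization f
   of a hypersurface; its Euclidean norm is the surface Jacobian. The library
   Jacobian matrix acts on row vectors: its i-th row is the i-th partial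
   derivative of f. *)
Definition param_normal (R : realType) (N : nat)
    (f : 'rV[R]_N.-1 -> 'rV[R]_N) (g : 'rV[R]_N.-1) : 'rV[R]_N :=
  \row_i ((-1) ^+ i * \det (col' i ('J f g))).

(* face_map k sends the parameter g of the k-th face to the point r(g) of the
   boundary of the reference element; face_flip k fixes the orientation of the
   normal. *)
Record element (R : realType) (N : nat) := Element {
  ref_elt : set 'rV[R]_N;
  elt_map : 'rV[R]_N -> 'rV[R]_N;
  nfaces : nat;
  face_dom : 'I_nfaces -> set 'rV[R]_N.-1;
  face_map : 'I_nfaces -> 'rV[R]_N.-1 -> 'rV[R]_N;
  face_flip : 'I_nfaces -> bool
}.

Definition elt_dom (R : realType) (N : nat) (E : element R N) : set 'rV[R]_N :=
  elt_map E @` ref_elt E.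

Definition elt_vol (R : realType) (N : nat) (E : element R N) : R :=
  fine (volume (elt_dom E)).

Definition elt_jac (R : realType) (N : nat) (E : element R N)
    (r : 'rV[R]_N) : R :=
  `|\det ('J (elt_map E) r)|.

Definition face_jac (R : realType) (N : nat) (E : element R N)
    (k : 'I_(nfaces E)) (g : 'rV[R]_N.-1) : 'rV[R]_N :=
  (-1) ^+ face_flip k *: param_normal (elt_map E \o face_map k) g.

Definition face_normal (R : realType) (N : nat) (E : element R N)
    (k : 'I_(nfaces E)) (g : 'rV[R]_N.-1) : 'rV[R]_N :=
  (norm2 (face_jac k g))^-1 *: face_jac k g.

(* The reference element is closed, so that interior traces are values of the
   solution on it. Outwardness of the normal is only required away from the
   edges of the faces, where it has a pointwise meaning; since the orientation
   is constant on each face, this determines the normal everywhere. *)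
Record element_wf (R : realType) (N : nat) (E : element R N) : Prop := {
  elt_compact : compact (ref_elt E);
  elt_vol_gt0 : 0 < elt_vol E;
  elt_map_inj : set_inj (interior (ref_elt E)) (elt_map E);
  elt_map_diff : forall r, ref_elt E r -> differentiable (elt_map E) r;
  elt_bndE : \bigcup_(k : 'I_(nfaces E)) (face_map k @` face_dom k) =
               ref_elt E `\` interior (ref_elt E);
  face_diff : forall (k : 'I_(nfaces E)) g, face_dom k g ->
    differentiable (elt_map E \o face_map k) g;
  face_outward : forall (k : 'I_(nfaces E)) g,
    interior (face_dom k) g -> face_jac k g != 0 ->
    let x := elt_map E (face_map k g) in
    let n := face_normal k g in
    \forall t \near 0^'+, ~ elt_dom E (x + t *: n) /\ elt_dom E (x - t *: n)
}.

(** ** Quadrature *)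

Record quadrature (R : realType) (N : nat) (E : element R N) := Quadrature {
  nvq : nat;
  vpt : 'I_nvq -> 'rV[R]_N;
  vwt : 'I_nvq -> R;
  nfq : 'I_(nfaces E) -> nat;
  fpt : forall k, 'I_(nfq k) -> 'rV[R]_N.-1;
  fwt : forall k, 'I_(nfq k) -> R
}.

(* r(g_{k,q}) *)
Definition fref (R : realType) (N : nat) (E : element R N) (Q : quadrature E)
    (k : 'I_(nfaces E)) (q : 'I_(nfq Q k)) : 'rV[R]_N :=
  face_map k (fpt q).

Definition fnormal (R : realType) (N : nat) (E : element R N)
    (Q : quadrature E) (k : 'I_(nfaces E)) (q : 'I_(nfq Q k)) : 'rV[R]_N :=
  face_normal k (fpt q).

Definition vfrac (R : realType) (N : nat) (E : element R N)
    (Q : quadrature E) (v : 'I_(nvq Q)) : R :=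
  elt_jac E (vpt v) * vwt v / elt_vol E.

Definition zeta (R : realType) (N : nat) (E : element R N)
    (Q : quadrature E) (k : 'I_(nfaces E)) (q : 'I_(nfq Q k)) : R :=
  norm2 (face_jac k (fpt q)) * fwt q / elt_vol E.

(* The last two fields express exactness of the volume quadrature for the
   volume of the element, and of the surface quadrature for the integral of
   the unit normal over the closed surface. *)
Record quadrature_wf (R : realType) (N : nat) (E : element R N)
    (Q : quadrature E) : Prop := {
  vpt_in : forall v : 'I_(nvq Q), ref_elt E (vpt v);
  vwt_gt0 : forall v : 'I_(nvq Q), 0 < vwt v;
  fpt_in : forall (k : 'I_(nfaces E)) (q : 'I_(nfq Q k)), face_dom k (fpt q);
  fwt_gt0 : forall (k : 'I_(nfaces E)) (q : 'I_(nfq Q k)), 0 < fwt q;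
  zeta_gt0 : forall (k : 'I_(nfaces E)) (q : 'I_(nfq Q k)), 0 < zeta q;
  vol_exact : \sum_(v < nvq Q) elt_jac E (vpt v) * vwt v = elt_vol E;
  normal_exact :
    \sum_(k < nfaces E) \sum_(q < nfq Q k) zeta q *: fnormal q = 0
}.

(** ** Polynomial space and interpolation *)

Definition peval (R : realType) (N : nat) (p : mpoly N R) (r : 'rV[R]_N) : R :=
  meval (r 0) p.

Definition in_span (R : realType) (N Np : nat) (b : 'I_Np -> mpoly N R)
    (p : mpoly N R) : Prop :=
  exists a : 'I_Np -> R, p = \sum_j a j *: b j.

(* b is a basis of an Np-dimensional space of polynomials, which contains the
   constants. *)
Record space_basis (R : realType) (N Np : nat) (b : 'I_Np -> mpoly N R) :
    Prop := {
  basis_free : forall a : 'I_Np -> R,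
    \sum_j a j *: b j = 0 -> forall j, a j = 0;
  basis_cst : in_span b 1
}.

(* phi is the family of Lagrange basis functions of the span of b at the
   volume quadrature points selected by sel, extended by 0. *)
Record lagrange_basis (R : realType) (N : nat) (E : element R N)
    (Q : quadrature E) (Np : nat) (b : 'I_Np -> mpoly N R)
    (sel : 'I_Np -> 'I_(nvq Q)) (phi : 'I_(nvq Q) -> mpoly N R) : Prop := {
  sel_inj : injective sel;
  interp_unit : (\matrix_(i, j) peval (b j) (vpt (sel i))) \in unitmx;
  phi_span : forall v, in_span b (phi v);
  phi_sel : forall i j, peval (phi (sel i)) (vpt (sel j)) = (i == j)%:R;
  phi_out : forall v, v \notin codom sel -> phi v = 0
}.

(** ** Discontinuous Galerkin solution *)

(* Values of a state-valued polynomial, given by its components. *)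
Definition sol_at (R : realType) (N : nat)
    (U : 'I_(1 + (N + 1)) -> mpoly N R) (r : 'rV[R]_N) : state R N :=
  \row_i peval (U i) r.

Definition tau (R : realType) (N : nat) : R :=
  Num.max (Num.sqrt N%:R) (Num.sqrt (2 + gamma R * (gamma R - 1))).

(* The neutral element 0 of the maxima is harmless: char_speed is
   nonnegative. *)
Definition lambda_star (R : realType) (N : nat) (E : element R N)
    (Q : quadrature E) (U : 'I_(1 + (N + 1)) -> mpoly N R) : R :=
  tau R N * \big[Num.max/0]_(k < nfaces E) \big[Num.max/0]_(q < nfq Q k)
              char_speed (sol_at U (fref q)).

Definition cell_average (R : realType) (N : nat) (E : element R N)
    (Q : quadrature E) (U : 'I_(1 + (N + 1)) -> mpoly N R) : state R N :=
  \sum_(v < nvq Q) vfrac v *: sol_at U (vpt v).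

(* The exterior trace is given face by face, as a function of the face
   parameter: it may be multivalued where faces meet. *)
Definition euler_step (R : realType) (N : nat) (E : element R N)
    (Q : quadrature E) (U : 'I_(1 + (N + 1)) -> mpoly N R)
    (Uext : 'I_(nfaces E) -> 'rV[R]_N.-1 -> state R N) (lambda dt : R) :
    state R N :=
  cell_average Q U -
  dt *: \sum_(k < nfaces E) \sum_(q < nfq Q k)
    zeta q *: llf_flux lambda (sol_at U (fref q)) (Uext k (fpt q)) (fnormal q).

Definition theta_vol (R : realType) (N : nat) (E : element R N)
    (Q : quadrature E) (phi : 'I_(nvq Q) -> mpoly N R)
    (theta : forall k : 'I_(nfaces E), 'I_(nfq Q k) -> R)
    (v : 'I_(nvq Q)) : R :=
  vfrac v - \sum_(k < nfaces E) \sum_(q < nfq Q k)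
              theta k q * peval (phi v) (fref q).

(* All the values U(y) for y in the element or on the exterior side of its
   boundary. *)
Definition sol_values (R : realType) (N : nat) (E : element R N)
    (U : 'I_(1 + (N + 1)) -> mpoly N R)
    (Uext : 'I_(nfaces E) -> 'rV[R]_N.-1 -> state R N) : set (state R N) :=
  sol_at U @` ref_elt E `|` \bigcup_(k : 'I_(nfaces E)) (Uext k @` face_dom k).

(* Infimum in the extended reals: it is the minimum whenever the latter is
   attained. *)
Definition min_entropy (R : realType) (N : nat) (s0 : R) (E : element R N)
    (U : 'I_(1 + (N + 1)) -> mpoly N R)
    (Uext : 'I_(nfaces E) -> 'rV[R]_N.-1 -> state R N) : \bar R :=
  ereal_inf [set (entropy s0 W)%:E | W in sol_values U Uext].

(* Main.v *)
Require Import Defs.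
From mathcomp Require Import all_boot all_order all_algebra.
From mathcomp Require Import all_classical all_reals all_analysis.
From mathcomp Require Import ring lra.
Import Order.TTheory GRing.Theory Num.Theory.

(** States of entropy at least s form the convex set p >= K rho^gamma, so a
    state V belongs to it as soon as the supporting linear functional at the
    state * that has the density and velocity of V and lies on the isentrope
    p = K rho^gamma is nonnegative at V. If V is an average, with weights w_i,
    of the states U_i - F(U_i).nu_i, and sum w_i nu_i = 0, that functional is
    the average of the productions
      (1 - u.nu) (rho |u - u*|^2 / 2 + q) - (p - p* ) (u - u* ).nu,
    where q >= 0 is the relative internal energy. For nu = n / lambda each of
    them is nonnegative when lambda - u.n >= c and, if p < p* and
    u.n < u*.n, also lambda - u*.n >= c*.

    With g = dt lambda zeta, so that 2 g <= theta, the Euler step is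
      sum_v theta_v U_v + sum (theta - 2 g) U+
        + sum 2 g [3/4 (U+ - F(U+).n / (3 lambda))
                   + 1/4 (U- - F(U-).n / lambda)].
    Let W be the g-weighted average of the states U+ - F(U+).n / (3 lambda).
    Since sum g n = 0, the first term in the brackets may be replaced by
    3/4 (W + F(W).n / (3 lambda)) without changing the sum. Both W and the
    resulting pair averages of W and U- are averages of the above kind. The
    bound 8/5 (|u| + c) <= lambda for U+ makes W slow, |u| + c* <= 3/4 lambda,
    which yields the conditions on the averaged states. *)

Set Implicit Arguments.
Unset Strict Implicit.
Unset Printing Implicit Defensive.

(** * Scalar inequalities *)

(** Weighted AM-GM. Writing the larger variable as the smaller one plus [h >= 0] turns the
    difference into a polynomial with nonnegative coefficients. *)
Lemma amgm_52 (R : realFieldType) (y z : R) : 0 <= y -> 0 <= z ->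
  7 * (z ^+ 2 * y ^+ 5) <= 5 * y ^+ 7 + 2 * z ^+ 7.
Proof.
move=> y0 z0; have [yz|/ltW zy] := leP y z.
- have -> : z = y + (z - y) by ring.
  have: 0 <= z - y by rewrite subr_ge0.
  move: (z - y) => h h0.
  rewrite -subr_ge0.
  have -> : 5 * y ^+ 7 + 2 * (y + h) ^+ 7 - 7 * ((y + h) ^+ 2 * y ^+ 5) =
    35 * (y ^+ 5 * h ^+ 2) + 70 * (y ^+ 4 * h ^+ 3) + 70 * (y ^+ 3 * h ^+ 4)
    + 42 * (y ^+ 2 * h ^+ 5) + 14 * (y * h ^+ 6) + 2 * h ^+ 7 by ring.
  by rewrite !addr_ge0 ?mulr_ge0 ?exprn_ge0 ?ler0n.
- have -> : y = z + (y - z) by ring.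
  have: 0 <= y - z by rewrite subr_ge0.
  move: (y - z) => h h0.
  rewrite -subr_ge0.
  have -> : 5 * (z + h) ^+ 7 + 2 * z ^+ 7 - 7 * (z ^+ 2 * (z + h) ^+ 5) =
    35 * (z ^+ 5 * h ^+ 2) + 105 * (z ^+ 4 * h ^+ 3) + 140 * (z ^+ 3 * h ^+ 4)
    + 98 * (z ^+ 2 * h ^+ 5) + 35 * (z * h ^+ 6) + 5 * h ^+ 7 by ring.
  by rewrite !addr_ge0 ?mulr_ge0 ?exprn_ge0 ?ler0n.
Qed.

Lemma amgm_6 (R : realFieldType) (y z : R) : 0 <= y -> 0 <= z ->
  6 * (y * z ^+ 5) <= 5 * z ^+ 6 + y ^+ 6.
Proof.
move=> y0 z0; have [yz|/ltW zy] := leP y z.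
- have -> : z = y + (z - y) by ring.
  have: 0 <= z - y by rewrite subr_ge0.
  move: (z - y) => h h0.
  rewrite -subr_ge0.
  have -> : 5 * (y + h) ^+ 6 + y ^+ 6 - 6 * (y * (y + h) ^+ 5) =
    15 * (y ^+ 4 * h ^+ 2) + 40 * (y ^+ 3 * h ^+ 3) + 45 * (y ^+ 2 * h ^+ 4)
    + 24 * (y * h ^+ 5) + 5 * h ^+ 6 by ring.
  by rewrite !addr_ge0 ?mulr_ge0 ?exprn_ge0 ?ler0n.
- have -> : y = z + (y - z) by ring.
  have: 0 <= y - z by rewrite subr_ge0.
  move: (y - z) => h h0.
  rewrite -subr_ge0.
  have -> : 5 * z ^+ 6 + (z + h) ^+ 6 - 6 * ((z + h) * z ^+ 5) =
    15 * (z ^+ 4 * h ^+ 2) + 20 * (z ^+ 3 * h ^+ 3) + 15 * (z ^+ 2 * h ^+ 4)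
    + 6 * (z * h ^+ 5) + h ^+ 6 by ring.
  by rewrite !addr_ge0 ?mulr_ge0 ?exprn_ge0 ?ler0n.
Qed.

(* Internal energy of (rho, p) relative to the state * of the isentrope, with
   rho = y^5 and p* = 5/7 z^7. *)
Definition rel_energy (R : realFieldType) (y z P : R) : R :=
  5 / 2 * P - 5 / 2 * (z ^+ 2 * y ^+ 5) + 5 / 7 * z ^+ 7.

Lemma rel_energy_ge0 (R : realFieldType) (y z P : R) : 0 <= y -> 0 <= z ->
  5 / 7 * y ^+ 7 <= P -> 0 <= rel_energy y z P.
Proof.
by move=> y0 z0 yP; have := amgm_52 y0 z0; rewrite /rel_energy; lra.
Qed.

(** Since 7/5 p = rho c^2, this controls the discriminant of the production, seen as a quadratic
    form in the normal velocity jump, when p >= p*. *)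
Lemma rel_energy_compress (R : realFieldType) (y z P : R) : 0 < y -> 0 < z ->
  5 / 7 * y ^+ 7 <= P -> 5 / 7 * z ^+ 7 <= P ->
  (P - 5 / 7 * z ^+ 7) ^+ 2 <= 14 / 5 * P * rel_energy y z P.
Proof.
move=> y0 z0 yP zP; rewrite /rel_energy.
have Pgt0 : 0 < P.
  by apply: lt_le_trans yP; rewrite mulr_gt0 ?exprn_gt0//; lra.
have [yz|zy] := leP y z.
- have h : z ^+ 2 * y ^+ 5 <= z ^+ 7.
    rewrite (_ : 7 = 2 + 5)%N // exprD ler_wpM2l ?exprn_ge0 ?(ltW z0)//.
    by rewrite ler_pXn2r// nnegrE ltW.
  move: (z ^+ 2 * y ^+ 5) (z ^+ 7) h zP (exprn_gt0 7 z0) => a b ab bP b0.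
  nra.
(* The claim on the isentrope [P = 5/7 y^7], up to a constant factor. Its two sides agree to second
   order at [y = z], hence the factor [(y - z) ^+ 3]. *)
- have base : 0 <= 30 * y ^+ 14 - 49 * (y ^+ 12 * z ^+ 2)
      + 24 * (y ^+ 7 * z ^+ 7) - 5 * z ^+ 14.
    have -> : 30 * y ^+ 14 - 49 * (y ^+ 12 * z ^+ 2)
      + 24 * (y ^+ 7 * z ^+ 7) - 5 * z ^+ 14 = (y - z) ^+ 3 *
      (30 * y ^+ 11 + 90 * (y ^+ 10 * z) + 131 * (y ^+ 9 * z ^+ 2)
       + 153 * (y ^+ 8 * z ^+ 3) + 156 * (y ^+ 7 * z ^+ 4)
       + 140 * (y ^+ 6 * z ^+ 5) + 105 * (y ^+ 5 * z ^+ 6)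
       + 75 * (y ^+ 4 * z ^+ 7) + 50 * (y ^+ 3 * z ^+ 8)
       + 30 * (y ^+ 2 * z ^+ 9) + 15 * (y * z ^+ 10) + 5 * z ^+ 11) by ring.
    have [y0' z0'] := (ltW y0, ltW z0).
    apply: mulr_ge0; first by rewrite exprn_ge0// subr_ge0 ltW.
    by rewrite !addr_ge0 ?mulr_ge0 ?exprn_ge0 ?ler0n.
  have := amgm_52 (ltW y0) (ltW z0).
  move: base; rewrite (_ : y ^+ 14 = y ^+ 7 * y ^+ 7); last by rewrite -exprD.
  rewrite (_ : z ^+ 14 = z ^+ 7 * z ^+ 7); last by rewrite -exprD.
  rewrite (_ : y ^+ 12 * z ^+ 2 = y ^+ 7 * (z ^+ 2 * y ^+ 5)); last first.
    by ring.
  move: yP; have := exprn_gt0 7 y0; have := exprn_gt0 7 z0.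
  move: (y ^+ 7) (z ^+ 7) (z ^+ 2 * y ^+ 5) => a b c b0 a0 aP base abc.
  (* The excess of the pressure over the isentrope enters quadratically; its linear coefficient is
     nonnegative by [amgm_52]. *)
  have e0 : 0 <= P - 5 / 7 * a by lra.
  have -> : P = 5 / 7 * a + (P - 5 / 7 * a) by lra.
  move: (P - _) e0 => e e0; rewrite -subr_ge0.
  have -> : 14 / 5 * (5 / 7 * a + e) *
       (5 / 2 * (5 / 7 * a + e) - 5 / 2 * c + 5 / 7 * b) -
       (5 / 7 * a + e - 5 / 7 * b) ^+ 2 =
     6 * e ^+ 2 + e * (60 / 7 * a + 24 / 7 * b - 7 * c)
     + 5 / 49 * (30 * (a * a) - 49 * (a * c) + 24 * (a * b) - 5 * (b * b))
    by field.
  have h1 : 0 <= 60 / 7 * a + 24 / 7 * b - 7 * c by lra.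
  have := mulr_ge0 e0 h1; have := sqr_ge0 e; lra.
Qed.

(** Discriminant criterion: after multiplication by [2 * D * r], complete the square of
    [D * r * s - delta]. *)
Lemma quad_form_ge (R : realFieldType) (D r q delta s : R) : 0 < D -> 0 < r ->
  delta ^+ 2 <= 2 * r * q * D ^+ 2 -> delta * s <= D * (r * s ^+ 2 / 2 + q).
Proof.
move=> D0 r0 h; have Dr : 0 < 2 * D * r by rewrite !mulr_gt0.
rewrite -subr_ge0 -(pmulr_rge0 _ Dr).
have := sqr_ge0 (D * r * s - delta); nra.
Qed.

(** Serves the expansion case p < p*: [w] is the velocity jump from u.n up to u*.n and [d] is lambda
    - u*.n, so [w + d] is lambda - u.n and the bound is cubic in [w]. *)
Lemma cubic_form_ge (R : realFieldType) (y z P d w : R) :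
  0 < y -> y <= z -> 5 / 7 * y ^+ 7 <= P -> z <= d -> 0 <= w ->
  (5 / 7 * z ^+ 7 - P) * w <=
    (w + d) * (y ^+ 5 * w ^+ 2 / 2 + rel_energy y z P).
Proof.
move=> y0 yz yP zd w0; rewrite /rel_energy.
have -> : z = y + (z - y) by ring.
have -> : P = 5 / 7 * y ^+ 7 + (P - 5 / 7 * y ^+ 7) by field.
have : 0 <= P - 5 / 7 * y ^+ 7 by lra.
have -> : d = y + (z - y) + (d - z) by ring.
have : 0 <= d - z by lra.
have : 0 <= z - y by lra.
move: (z - y) (P - _) (d - z) => h e c h0 c0 e0 {yP yz zd z d P}.
rewrite -subr_ge0.
set X := (X in 0 <= X).
(* The quadratic terms form a perfect square because z <= d is sharp. *)
have -> : X = y ^+ 5 / 2 * (y + h) * (w - 5 * h) ^+ 2 + e * w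
     + 5 / 2 * (w + (y + h + c)) * e + y ^+ 5 / 2 * w ^+ 3
     + 5 / 2 * (y ^+ 5 * h ^+ 2 * w)
     + c * (y ^+ 5 / 2 * w ^+ 2 + 25 / 2 * (y ^+ 5 * h ^+ 2))
     + (y + h + c) * (25 * (y ^+ 4 * h ^+ 3) + 25 * (y ^+ 3 * h ^+ 4)
       + 15 * (y ^+ 2 * h ^+ 5) + 5 * (y * h ^+ 6) + 5 / 7 * h ^+ 7)
  by rewrite /X; field.
have y0' := ltW y0.
by do ![assumption | apply: ler0n | apply: addr_ge0 | apply: divr_ge0 |
  apply: sqr_ge0 | apply: mulr_ge0 | apply: exprn_ge0].
Qed.

(* s stands for (u - u* ).n and D for lambda - u.n, so that D + s is
   lambda - u*.n and the second hypothesis on D reads c <= D. *)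
Lemma entropy_production (R : realFieldType) (y z P D s : R) :
  0 < y -> 0 < z -> 5 / 7 * y ^+ 7 <= P -> 0 < D ->
  7 * P <= 5 * (D ^+ 2 * y ^+ 5) ->
  (P < 5 / 7 * z ^+ 7 -> s < 0 -> z <= D + s) ->
  (P - 5 / 7 * z ^+ 7) * s <= D * (y ^+ 5 * s ^+ 2 / 2 + rel_energy y z P).
Proof.
move=> y0 z0 yP D0 DP zD.
have q0 : 0 <= rel_energy y z P by rewrite rel_energy_ge0// ltW.
(* In compression the discriminant decides. Below the pressure [5/7 z^7], [s >= 0] makes the left
   side nonpositive, and only [s < 0] calls for the bound on [z]. *)
have [zP|Pz] := leP (5 / 7 * z ^+ 7) P.
  apply: quad_form_ge; rewrite ?exprn_gt0//.
  have := rel_energy_compress y0 z0 yP zP; nra.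
have [s0|s0] := leP 0 s.
  rewrite (@le_trans _ _ 0)//; first by rewrite mulr_le0_ge0 ?subr_le0// ltW.
  apply: mulr_ge0 (ltW D0) (addr_ge0 _ q0); rewrite divr_ge0 ?ler0n//.
  by rewrite mulr_ge0 ?sqr_ge0 ?exprn_ge0 ?(ltW y0).
have yz : y <= z.
  rewrite -(@ler_pXn2r _ 7)// ?nnegrE ?ltW//; lra.
have := @cubic_form_ge _ y z P (D + s) (- s) y0 yz yP (zD Pz s0).
rewrite oppr_ge0 (ltW s0) sqrrN addrCA addNr addr0 => /(_ isT).
lra.
Qed.

(** * Averages of flux-split states *)

Lemma dotvC (R : realType) n (u v : 'rV[R]_n) : dotv u v = dotv v u.
Proof. by apply: eq_bigr => i _; rewrite mulrC. Qed.

Lemma dotvDl (R : realType) n (u v w : 'rV[R]_n) :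
  dotv (u + v) w = dotv u w + dotv v w.
Proof. by rewrite -big_split; apply: eq_bigr => i _; rewrite mxE mulrDl. Qed.

Lemma dotvZl (R : realType) n a (u w : 'rV[R]_n) :
  dotv (a *: u) w = a * dotv u w.
Proof.
by rewrite /dotv big_distrr; apply: eq_bigr => i _; rewrite mxE /= mulrA.
Qed.

Lemma dotvDr (R : realType) n (u v w : 'rV[R]_n) :
  dotv w (u + v) = dotv w u + dotv w v.
Proof. by rewrite !(dotvC w) dotvDl. Qed.

Lemma dotvZr (R : realType) n a (u w : 'rV[R]_n) :
  dotv w (a *: u) = a * dotv w u.
Proof. by rewrite !(dotvC w) dotvZl. Qed.

Lemma dotvNl (R : realType) n (u w : 'rV[R]_n) : dotv (- u) w = - dotv u w.
Proof. by rewrite -scaleN1r dotvZl mulN1r. Qed.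

Lemma dotvNr (R : realType) n (u w : 'rV[R]_n) : dotv w (- u) = - dotv w u.
Proof. by rewrite -scaleN1r dotvZr mulN1r. Qed.

Lemma dotvr0 (R : realType) n (w : 'rV[R]_n) : dotv w 0 = 0.
Proof. by apply: big1 => i _; rewrite mxE mulr0. Qed.

Lemma dotv_suml (R : realType) n (I : finType) (F : I -> 'rV[R]_n) w :
  dotv (\sum_i F i) w = \sum_i dotv (F i) w.
Proof.
rewrite /dotv exchange_big; apply: eq_bigr => j _.
by rewrite summxE /= big_distrl.
Qed.

Lemma dotv_sumr (R : realType) n (I : finType) (F : I -> 'rV[R]_n) w :
  dotv w (\sum_i F i) = \sum_i dotv w (F i).
Proof. by rewrite dotvC dotv_suml; apply: eq_bigr => i _; rewrite dotvC. Qed.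

Lemma dotvv_ge0 (R : realType) n (u : 'rV[R]_n) : 0 <= dotv u u.
Proof. by apply: sumr_ge0 => i _; rewrite -expr2 sqr_ge0. Qed.

Lemma sqr_norm2 (R : realType) n (u : 'rV[R]_n) : norm2 u ^+ 2 = dotv u u.
Proof. by rewrite sqr_sqrtr// dotvv_ge0. Qed.

Lemma sqr_dotv_unit (R : realType) n (u e : 'rV[R]_n) : dotv e e = 1 ->
  dotv u e ^+ 2 <= dotv u u.
Proof.
move=> e1; have := dotvv_ge0 (u - dotv u e *: e).
rewrite !(dotvDl, dotvDr, dotvNl, dotvNr, dotvZl, dotvZr) e1 (dotvC e u); lra.
Qed.

Lemma norm_dotv_unit (R : realType) n (u e : 'rV[R]_n) : dotv e e = 1 ->
  `|dotv u e| <= norm2 u.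
Proof. by move=> e1; rewrite -sqrtr_sqr ler_sqrt ?dotvv_ge0 ?sqr_dotv_unit. Qed.

Lemma dotv_unit_le (R : realType) n (u e : 'rV[R]_n) : dotv e e = 1 ->
  - norm2 u <= dotv u e <= norm2 u.
Proof. by move=> e1; rewrite -ler_norml norm_dotv_unit. Qed.

Section States.
Variables (R : realType) (N : nat).
Implicit Types (U V : state R N) (I : finType).

Lemma density_sum I (w : I -> R) (V : I -> state R N) :
  density (\sum_i w i *: V i) = \sum_i w i * density (V i).
Proof.
rewrite /density mxE summxE; apply: eq_bigr => i _.
by rewrite !mxE.
Qed.

Lemma energy_sum I (w : I -> R) (V : I -> state R N) :
  energy (\sum_i w i *: V i) = \sum_i w i * energy (V i).
Proof.
rewrite /energy !mxE summxE; apply: eq_bigr => i _.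
by rewrite !mxE.
Qed.

Lemma momentum_sum I (w : I -> R) (V : I -> state R N) :
  momentum (\sum_i w i *: V i) = \sum_i w i *: momentum (V i).
Proof.
by rewrite /momentum !linear_sum; apply: eq_bigr => i _; rewrite !linearZ.
Qed.

Lemma densityB U V : density (U - V) = density U - density V.
Proof. by rewrite /density !mxE. Qed.

Lemma energyB U V : energy (U - V) = energy U - energy V.
Proof. by rewrite /energy !mxE. Qed.

Lemma momentumB U V : momentum (U - V) = momentum U - momentum V.
Proof. by rewrite /momentum !linearB. Qed.

Lemma density_mk rho (m : 'rV[R]_N) E : density (mk_state rho m E) = rho.
Proof. by rewrite /density /mk_state row_mxKl !mxE. Qed.

Lemma momentum_mk rho (m : 'rV[R]_N) E : momentum (mk_state rho m E) = m.
Proof. by rewrite /momentum /mk_state row_mxKr row_mxKl. Qed.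

Lemma energy_mk rho (m : 'rV[R]_N) E : energy (mk_state rho m E) = E.
Proof. by rewrite /energy /mk_state !row_mxKr !mxE. Qed.

Lemma momentumE U : density U != 0 -> momentum U = density U *: velocity U.
Proof. by move=> U0; rewrite /velocity scalerA divff// scale1r. Qed.

Lemma pressureE U : pressure U =
  2 / 5 * (energy U - 1 / 2 * density U * dotv (velocity U) (velocity U)).
Proof. by rewrite /pressure /gamma sqr_norm2; field. Qed.

Lemma fluxZ U a (n : 'rV[R]_N) : flux U (a *: n) = a *: flux U n.
Proof.
rewrite /flux /mk_state dotvZr !scale_row_mx.
congr row_mx; last congr row_mx.
- by rewrite scale_scalar_mx; congr _%:M; ring.
- by rewrite scalerDr !scalerA [a * pressure U]mulrC.
- by rewrite scale_scalar_mx; congr _%:M; ring.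
Qed.

Lemma fluxD U (m n : 'rV[R]_N) : flux U (m + n) = flux U m + flux U n.
Proof.
rewrite /flux /mk_state dotvDr !add_row_mx.
congr row_mx; last congr row_mx.
- by rewrite -raddfD; congr _%:M; ring.
- by rewrite scalerDl scalerDr addrACA.
- by rewrite -raddfD; congr _%:M; ring.
Qed.

Lemma flux0 U : flux U 0 = 0.
Proof. by rewrite -[0 in LHS](scale0r 0) fluxZ scale0r. Qed.

Lemma flux_sum U I (F : I -> 'rV[R]_N) :
  flux U (\sum_i F i) = \sum_i flux U (F i).
Proof. by apply: (big_morph (flux U)) => [m n|]; rewrite ?fluxD ?flux0. Qed.

(** For a = |b|^2/2 - 5/2 z^2 this is the linear part of the supporting functional at the state of
    velocity [b] and sound speed [z] on the isentrope; the constant part, scaled by [k], is 5/7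
    z^7. *)
Definition pairing (a : R) (b : 'rV[R]_N) U : R :=
  energy U - dotv (momentum U) b + a * density U.

Lemma pairing_sum a b I (w : I -> R) (V : I -> state R N) :
  pairing a b (\sum_i w i *: V i) = \sum_i w i * pairing a b (V i).
Proof.
rewrite /pairing energy_sum density_sum momentum_sum dotv_suml.
rewrite -sumrB big_distrr -big_split; apply: eq_bigr => i _ /=.
by rewrite dotvZl; ring.
Qed.

Lemma density_split U (n : 'rV[R]_N) :
  density (U - flux U n) = density U * (1 - dotv (velocity U) n).
Proof. by rewrite densityB density_mk; ring. Qed.

Lemma momentum_split U (n e : 'rV[R]_N) : density U != 0 ->
  dotv (momentum (U - flux U n)) e =
    density U * (1 - dotv (velocity U) n) * dotv (velocity U) e
    - pressure U * dotv n e.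
Proof.
move=> U0; rewrite momentumB momentum_mk momentumE//.
by rewrite !(dotvDl, dotvNl, dotvZl); ring.
Qed.

Lemma energy_split U (n : 'rV[R]_N) :
  energy (U - flux U n) =
    energy U * (1 - dotv (velocity U) n) - pressure U * dotv (velocity U) n.
Proof. by rewrite energyB energy_mk; ring. Qed.

(* On the isentrope p = K rho^gamma the sound speed y satisfies k rho = y^5 and
   k p = 5/7 y^7 for a scale k depending on K: parametrizing by y makes all the
   powers integral. *)
Definition above_isentrope (k y : R) U : Prop :=
  [/\ 0 < y, k * density U = y ^+ 5 & 5 / 7 * y ^+ 7 <= k * pressure U].

Lemma above_density_gt0 k y U : 0 < k -> above_isentrope k y U -> 0 < density U.
Proof.
by move=> k0 [y0 e _]; rewrite -(pmulr_rgt0 _ k0) e exprn_gt0.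
Qed.

Definition production (k y z : R) (b n : 'rV[R]_N) U : R :=
  let u := velocity U - b in
  (1 - dotv (velocity U) n) *
    (y ^+ 5 * dotv u u / 2 + rel_energy y z (k * pressure U))
  - (k * pressure U - 5 / 7 * z ^+ 7) * dotv u n.

(** What remains beside the pairing is affine in [n], so that averaging over directions of mean zero
    leaves only the constant 5/7 z^7. *)
Lemma production_split k y z (b n : 'rV[R]_N) U :
  0 < k -> above_isentrope k y U ->
  production k y z b n U =
    k * pairing (dotv b b / 2 - 5 / 2 * z ^+ 2) b (U - flux U n)
    + 5 / 7 * z ^+ 7 * (1 - dotv b n).
Proof.
move=> k0 Uy; have U0 := above_density_gt0 k0 Uy; case: Uy => y0 e _.
rewrite /pairing density_split energy_split momentum_split ?gt_eqF//.
rewrite /production /rel_energy -e.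
have -> : energy U = 5 / 2 * pressure U
   + 1 / 2 * density U * dotv (velocity U) (velocity U).
  by rewrite pressureE; field.
rewrite !(dotvDl, dotvDr, dotvNl, dotvNr) (dotvC b (velocity U)) (dotvC n b).
by field.
Qed.

(** The average of [production_split] loses its directions and equals 5/2 (k p - 5/7 z^7) at [V];
    nonnegative productions thus put [V] above the isentrope. *)
Lemma mixture k z I (w : I -> R) (nu : I -> 'rV[R]_N) (U : I -> state R N)
    (y : I -> R) (V := \sum_i w i *: (U i - flux (U i) (nu i))) :
  0 < k -> 0 < z -> k * density V = z ^+ 5 ->
  (forall i, 0 <= w i) -> \sum_i w i = 1 -> \sum_i w i *: nu i = 0 ->
  (forall i, above_isentrope k (y i) (U i)) ->
  (forall i, 0 <= production k (y i) z (velocity V) (nu i) (U i)) ->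
  above_isentrope k z V.
Proof.
move=> k0 z0 Vz w0 w1 nu0 Uy prod_ge0; split => //.
have V0 : 0 < density V by rewrite -(pmulr_rgt0 _ k0) Vz exprn_gt0.
set b := velocity V in prod_ge0.
have : 0 <= \sum_i w i * production k (y i) z b (nu i) (U i).
  by apply: sumr_ge0 => i _; rewrite mulr_ge0.
have -> : \sum_i w i * production k (y i) z b (nu i) (U i) =
   k * pairing (dotv b b / 2 - 5 / 2 * z ^+ 2) b V + 5 / 7 * z ^+ 7.
  transitivity (\sum_i (k * (w i *
      pairing (dotv b b / 2 - 5 / 2 * z ^+ 2) b (U i - flux (U i) (nu i)))
      + 5 / 7 * z ^+ 7 * (w i - dotv b (w i *: nu i)))).
    by apply: eq_bigr => i _; rewrite production_split// dotvZr; ring.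
  rewrite big_split -!big_distrr /= sumrB w1 -dotv_sumr nu0.
  by rewrite dotvr0 subr0 mulr1 -pairing_sum.
rewrite /pairing momentumE ?gt_eqF// dotvZl -/b.
have -> : energy V = 5 / 2 * pressure V + 1 / 2 * density V * dotv b b.
  by rewrite pressureE; field.
have -> : k * (5 / 2 * pressure V + 1 / 2 * density V * dotv b b -
   density V * dotv b b + (dotv b b / 2 - 5 / 2 * z ^+ 2) * density V) =
   5 / 2 * (k * pressure V) - 5 / 2 * z ^+ 2 * (k * density V) by field.
rewrite Vz -(mulrA _ (z ^+ 2)) -exprD; lra.
Qed.

(** Reduction to [entropy_production]: a tangential velocity jump only adds kinetic energy. The last
    two conditions say c <= L - u.n and, in expansion, z <= L - b.n. *)
Lemma production_ge0 k y z L (b n : 'rV[R]_N) U :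
  above_isentrope k y U -> 0 < z -> 0 < L -> dotv n n = 1 ->
  0 < L - dotv (velocity U) n ->
  7 * (k * pressure U) <= 5 * ((L - dotv (velocity U) n) ^+ 2 * y ^+ 5) ->
  (k * pressure U < 5 / 7 * z ^+ 7 -> dotv (velocity U) n < dotv b n ->
     z <= L - dotv b n) ->
  0 <= production k y z b (L^-1 *: n) U.
Proof.
case=> y0 _ yP z0 L0 n1 D0 DP zL.
rewrite /production !dotvZr -(pmulr_rge0 _ L0).
set u := velocity U; set P := k * pressure U in yP DP zL *.
have := @entropy_production _ y z P (L - dotv u n) (dotv (u - b) n).
have -> : L - dotv u n + dotv (u - b) n = L - dotv b n.
  by rewrite dotvDl dotvNl; ring.
rewrite {1}dotvDl dotvNl subr_lt0 => /(_ y0 z0 yP D0 DP zL) H.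
have -> : L * ((1 - L^-1 * dotv u n) * (y ^+ 5 * dotv (u - b) (u - b) / 2
    + rel_energy y z P) - (P - 5 / 7 * z ^+ 7) * (L^-1 * dotv (u - b) n)) =
  (L - dotv u n) * (y ^+ 5 * dotv (u - b) (u - b) / 2 + rel_energy y z P)
  - (P - 5 / 7 * z ^+ 7) * dotv (u - b) n.
  by field; rewrite gt_eqF.
rewrite subr_ge0 (le_trans H)// ler_pM2l// lerD2r ler_pM2r ?invr_gt0 ?ltr0n//.
by rewrite ler_pM2l ?exprn_gt0// sqr_dotv_unit.
Qed.

End States.

(** * Elementary inequalities and sound speeds *)

Lemma root5 (R : realType) (x : R) : 0 < x -> exists2 z : R, 0 < z & x = z ^+ 5.
Proof.
move=> x0; exists (x `^ 5^-1); first exact: powR_gt0.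
by rewrite -powR_mulrn ?powR_ge0// -powRrM mulVf ?pnatr_eq0// powRr1 ?ltW.
Qed.

(** Tangent line at z^5 of t |-> t^(6/5), with an upper bound [x] for the fifth root of [m]. The
    claim is linear in [m]: it is clear if [6 z <= 5 x], and otherwise worst at m = x^5, where it is
    [amgm_6]. *)
Lemma tangent_65 (R : realFieldType) (m x z : R) :
  0 <= x -> 0 <= z -> 0 <= m <= x ^+ 5 -> 6 * (z * m) <= 5 * (m * x) + z ^+ 6.
Proof.
move=> x0 z0 /andP[m0 mx].
have [xz|xz] := leP (6 * z) (5 * x).
  have := mulr_ge0 m0 (_ : 0 <= 5 * x - 6 * z); rewrite subr_ge0 => /(_ xz).
  have := exprn_ge0 6 z0; lra.
have h : m * (6 * z - 5 * x) <= x ^+ 5 * (6 * z - 5 * x).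
  by rewrite ler_wpM2r// subr_ge0 ltW.
have := amgm_6 z0 x0; have := exprSr x 5; lra.
Qed.

Lemma bernoulli_5 (R : realFieldType) (x : R) : 0 <= x ->
  1 + 5 * x <= (1 + x) ^+ 5.
Proof.
move=> x0; rewrite -subr_ge0.
have -> : (1 + x) ^+ 5 - (1 + 5 * x) =
  10 * x ^+ 2 + 10 * x ^+ 3 + 5 * x ^+ 4 + x ^+ 5 by ring.
by rewrite !addr_ge0 ?mulr_ge0 ?exprn_ge0 ?ler0n.
Qed.

Lemma convex_gt0 (R : realType) (I : finType) (w f : I -> R) :
  (forall i, 0 <= w i) -> \sum_i w i = 1 -> (forall i, 0 < f i) ->
  0 < \sum_i w i * f i.
Proof.
move=> w0 w1 f0.
have wf i : 0 <= w i * f i by rewrite mulr_ge0// ltW.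
rewrite lt0r sumr_ge0 ?andbT//; apply/negP => /eqP /psumr_eq0P H.
suff : \sum_i w i = 0 by rewrite w1 => /eqP; rewrite oner_eq0.
apply: big1 => i _; have /eqP := H (fun i _ => wf i) i isT.
by rewrite mulf_eq0 (gt_eqF (f0 i)) orbF => /eqP.
Qed.

Section Speeds.
Variables (R : realType) (N : nat).
Implicit Types (U V : state R N).

Lemma norm2_ge0 (u : 'rV[R]_N) : 0 <= norm2 u.
Proof. exact: sqrtr_ge0. Qed.

Lemma sound_speed_gt0 U : admissible U -> 0 < sound_speed U.
Proof.
case=> r0 p0; rewrite sqrtr_gt0 divr_gt0// mulr_gt0//.
by rewrite /gamma divr_gt0 ?ltr0n.
Qed.

Lemma sqr_sound_speed U : admissible U ->
  5 * sound_speed U ^+ 2 * density U = 7 * pressure U.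
Proof.
case=> r0 p0; rewrite /sound_speed sqr_sqrtr /gamma; last first.
  by rewrite divr_ge0 ?(ltW r0)// mulr_ge0 ?(ltW p0)// divr_ge0 ?ler0n.
by field; rewrite gt_eqF.
Qed.

Lemma above_sound k y U : admissible U -> above_isentrope k y U ->
  7 * (k * pressure U) = 5 * sound_speed U ^+ 2 * y ^+ 5.
Proof. by move=> aU [_ <- _]; have := sqr_sound_speed aU; nra. Qed.

(** [y] is the sound speed on the isentrope at the same density, and a higher pressure only raises
    it. *)
Lemma above_le_sound k y U : 0 < k -> admissible U -> above_isentrope k y U ->
  y <= sound_speed U.
Proof.
move=> k0 aU yU; have := above_sound aU yU; have c0 := sound_speed_gt0 aU.
case: yU => y0 _ yP e.
have h : y ^+ 2 * y ^+ 5 <= sound_speed U ^+ 2 * y ^+ 5.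
  by rewrite -exprD; lra.
move: h; rewrite ler_pM2r ?exprn_gt0//.
by rewrite ler_pXn2r// nnegrE ltW.
Qed.

End Speeds.

(** For an interior trace, [x], [c], [y] are speed, sound speed and isentropic sound speed, and [a]
    is 1 - u.n / (3 L). Rescaled by [L], speed plus sound speed is at most 5/8; the gap to 3/4
    absorbs the pressure term. *)
Lemma interior_momentum_bound (R : realFieldType) (L x c y a : R) :
  0 < L -> 0 <= x -> 0 < y -> y <= c -> 8 / 5 * (x + c) <= L -> 19 / 24 <= a ->
  a * x + 5 / 21 * (c ^+ 2 / L) <= a * (3 / 4 * L - y * (1 + x / (15 * L))).
Proof.
move=> L0 x0 y0 yc xc a19.
have [X xE] : exists X, x = L * X by exists (x / L); field; rewrite gt_eqF.
have [C cE] : exists C, c = L * C by exists (c / L); field; rewrite gt_eqF.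
have [Y yE] : exists Y, y = L * Y by exists (y / L); field; rewrite gt_eqF.
move: x0 y0 yc xc; rewrite xE cE yE pmulr_rge0// pmulr_rgt0// ler_pM2l//.
move=> X0 Y0 YC; rewrite -mulrDr mulrCA -[leRHS]mulr1 ler_pM2l// => XC.
rewrite -subr_ge0; set E := (E in 0 <= E).
have -> : E = L * (a * (3 / 4 - Y * (1 + X / 15) - X) - 5 / 21 * C ^+ 2).
  by rewrite /E; field; rewrite gt_eqF.
rewrite pmulr_rge0// subr_ge0.
have h : C ^+ 2 <= (5 / 8) * C by nra.
have h2 : 3 / 4 - C * (1 + X / 15) - X <= 3 / 4 - Y * (1 + X / 15) - X by nra.
(* 25/168 is 5/21 times 5/8, and 19/24 is the lower bound of [a]. *)
have h3 : 25 / 168 * C <= 19 / 24 * (3 / 4 - C * (1 + X / 15) - X) by nra.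
have h4 : 0 <= 3 / 4 - C * (1 + X / 15) - X by nra.
have := ler_pM (_ : 0 <= 19 / 24) h4 a19 h2; lra.
Qed.

(** 25/14 c^2 + x^2/2 is the energy per unit mass, and 5/21 c^2 x/L bounds the contribution of the
    pressure to the split energy. *)
Lemma interior_energy_bound (R : realFieldType) (L x c a : R) :
  0 < L -> 0 <= x -> 0 < c -> 8 / 5 * (x + c) <= L -> 19 / 24 <= a ->
  (25 / 14 * c ^+ 2 + 1 / 2 * x ^+ 2) * a + 5 / 21 * (c ^+ 2 * (x / L)) <=
    31 / 40 * L ^+ 2 * a.
Proof.
move=> L0 x0 c0 xc a19.
have [X xE] : exists X, x = L * X by exists (x / L); field; rewrite gt_eqF.
have [C cE] : exists C, c = L * C by exists (c / L); field; rewrite gt_eqF.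
move: x0 c0 xc; rewrite xE cE pmulr_rge0// pmulr_rgt0//.
move=> X0 C0; rewrite -mulrDr mulrCA -[leRHS]mulr1 ler_pM2l// => XC.
rewrite -subr_ge0; set E := (E in 0 <= E).
have -> : E = L ^+ 2 * (a * (31 / 40 - 25 / 14 * C ^+ 2 - 1 / 2 * X ^+ 2)
    - 5 / 21 * (C ^+ 2 * X)).
  by rewrite /E; field; rewrite gt_eqF.
rewrite pmulr_rge0 ?exprn_gt0// subr_ge0.
have h : C ^+ 2 <= (5 / 8 - X) ^+ 2 by rewrite ler_sqr ?nnegrE; lra.
have h0 : C ^+ 2 * X <= (5 / 8) ^+ 2 * X by nra.
have h3 : 5 / 21 * ((5 / 8) ^+ 2 * X) <=
    19 / 24 * (31 / 40 - 25 / 14 * C ^+ 2 - 1 / 2 * X ^+ 2) by nra.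
have h4 : 0 <= 31 / 40 - 25 / 14 * C ^+ 2 - 1 / 2 * X ^+ 2 by nra.
have := ler_wpM2r h4 a19; lra.
Qed.

(** * The average of the interior traces *)

Section InteriorAverage.
Variables (R : realType) (N : nat) (I : finType) (k L : R).
Variables (w y : I -> R) (n : I -> 'rV[R]_N) (U : I -> state R N).
Hypotheses (k0 : 0 < k) (L0 : 0 < L).
Hypotheses (w0 : forall i, 0 <= w i) (w1 : \sum_i w i = 1).
Hypotheses (n1 : forall i, dotv (n i) (n i) = 1) (wn : \sum_i w i *: n i = 0).
Hypotheses (aU : forall i, admissible (U i)).
Hypotheses (yU : forall i, above_isentrope k (y i) (U i)).
Hypotheses (UL : forall i, 8 / 5 * char_speed (U i) <= L).

Let nu i := (3 * L)^-1 *: n i.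
Let W := \sum_i w i *: (U i - flux (U i) (nu i)).
Let a i := 1 - dotv (velocity (U i)) (nu i).
(** By [density_split], [k] times the density of the split state. *)
Let m i := y i ^+ 5 * a i.

Let y0 i : 0 < y i. Proof. by case: (yU i). Qed.

Let aE i : a i = 1 - dotv (velocity (U i)) (n i) / (3 * L).
Proof. by rewrite /a dotvZr mulrC. Qed.

Let speed_ge0 i : 0 <= norm2 (velocity (U i)). Proof. exact: norm2_ge0. Qed.

Let y_le_c i : y i <= sound_speed (U i).
Proof. exact: above_le_sound (aU i) (yU i). Qed.

(** The speed of a trace is at most 5/8 L, and 19/24 = 1 - (5/8)/3. *)
Let a_bounds i :
  19 / 24 <= a i <= 1 + norm2 (velocity (U i)) / (3 * L).
Proof.
have /andP[] := dotv_unit_le (velocity (U i)) (n1 i).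
have := UL i; rewrite /char_speed.
have := sound_speed_gt0 (aU i); have := speed_ge0 i.
rewrite aE; move: (norm2 _) (sound_speed _) (dotv _ _) => x c d x0 c0 xc xd dx.
have L3 : 0 < 3 * L by rewrite mulr_gt0.
rewrite lerBrDr addrC -lerBrDr ler_pdivrMr//; apply/andP; split; first by lra.
by rewrite lerD2l -mulNr ler_pM2r ?invr_gt0//; lra.
Qed.

Let a0 i : 0 < a i.
Proof. by have /andP[+ _] := a_bounds i; lra. Qed.

Let m0 i : 0 < m i.
Proof. by rewrite mulr_gt0 ?exprn_gt0. Qed.

Let densityW : k * density W = \sum_i w i * m i.
Proof.
rewrite /W density_sum big_distrr; apply: eq_bigr => i _ /=.
by rewrite density_split mulrCA mulrA /m /a; case: (yU i) => _ <- _; ring.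
Qed.

Let densityW_gt0 : 0 < density W.
Proof. by rewrite -(pmulr_rgt0 _ k0) densityW convex_gt0. Qed.

Let Pc i : k * pressure (U i) = 5 / 7 * sound_speed (U i) ^+ 2 * y i ^+ 5.
Proof. by have := above_sound (aU i) (yU i); lra. Qed.

(* Jensen's inequality for the convex function t |-> t ^ (6/5), through its
   tangent at the averaged mass. *)
Let velocityW_le z e : 0 < z -> k * density W = z ^+ 5 -> dotv e e = 1 ->
  dotv (velocity W) e + z <= 3 / 4 * L.
Proof.
move=> z0 Wz e1; pose x i := norm2 (velocity (U i)).
(* An upper bound for the fifth root of [m i]: by Bernoulli, a <= 1 + x/(3 L) <= (1 + x/(15
   L))^5. *)
pose zeta i := y i * (1 + x i / (15 * L)).
have momW : k * density W * dotv (velocity W) e =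
    \sum_i w i * (m i * dotv (velocity (U i)) e
      - k * pressure (U i) * dotv (nu i) e).
  rewrite -mulrA -dotvZl -momentumE ?gt_eqF// /W momentum_sum dotv_suml.
  rewrite big_distrr; apply: eq_bigr => i _ /=.
  rewrite dotvZl momentum_split ?gt_eqF//; last by case: (aU i).
  by rewrite /m /a; case: (yU i) => _ <- _; ring.
have zeta0 i : 0 <= zeta i.
  rewrite mulr_ge0 ?(ltW (y0 i))// addr_ge0// divr_ge0 ?norm2_ge0//.
  by rewrite mulr_ge0// ltW.
have m_zeta i : 0 <= m i <= zeta i ^+ 5.
  rewrite (ltW (m0 i)) /m /zeta exprMn ler_pM2l ?exprn_gt0 //=.
  have /andP[_ h] := a_bounds i; apply: (le_trans h).
  have := @bernoulli_5 _ (x i / (15 * L)).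
  rewrite divr_ge0 ?norm2_ge0//; last first.
    by rewrite mulr_ge0// ltW.
  move=> /(_ isT); apply: le_trans.
  rewrite lerD2l le_eqVlt; apply/orP; left; apply/eqP.
  by rewrite /x; field; rewrite gt_eqF.
have bound i : m i * dotv (velocity (U i)) e
      - k * pressure (U i) * dotv (nu i) e <= m i * (3 / 4 * L - zeta i).
  have /andP[ai _] := a_bounds i.
  have := interior_momentum_bound L0 (speed_ge0 i) (y0 i) (y_le_c i) (UL i) ai.
  have /andP[_ ue] := dotv_unit_le (velocity (U i)) e1.
  have /andP[ne _] := dotv_unit_le (n i) e1.
  move: ne; rewrite {1}/norm2 n1 sqrtr1 => ne.
  have q0 : 0 <= sound_speed (U i) ^+ 2 / L by rewrite divr_ge0 ?sqr_ge0 ?ltW.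
  rewrite -/(x i) -/(zeta i) Pc /nu (dotvZl _ (n i)) /m => h.
  have -> : 5 / 7 * sound_speed (U i) ^+ 2 * y i ^+ 5 *
      ((3 * L)^-1 * dotv (n i) e) = y i ^+ 5 *
      (5 / 21 * (sound_speed (U i) ^+ 2 / L) * dotv (n i) e).
    by field; rewrite gt_eqF.
  move: (exprn_gt0 5 (y0 i)) ai h q0 ne ue.
  rewrite -/(x i); move: (y i ^+ 5) (a i) (_ / L) (dotv (n i) e) (dotv _ e).
  move=> Y A q ne d Y0 A0 h q0 ne1 dx.
  rewrite -!mulrA -mulrBr ler_pM2l//; nra.
have Jensen : 6 * (z * z ^+ 5) <= 5 * (\sum_i w i * (m i * zeta i)) + z ^+ 6.
  have : 0 <= \sum_i w i * (5 * (m i * zeta i) + z ^+ 6 - 6 * (z * m i)).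
    apply: sumr_ge0 => i _; rewrite mulr_ge0// subr_ge0.
    exact: tangent_65 (zeta0 i) (ltW z0) (m_zeta i).
  have -> : \sum_i w i * (5 * (m i * zeta i) + z ^+ 6 - 6 * (z * m i)) =
      5 * (\sum_i w i * (m i * zeta i)) + z ^+ 6 * (\sum_i w i)
      - 6 * z * (\sum_i w i * m i).
    rewrite !big_distrr -big_split -sumrB; apply: eq_bigr => i _ /=; ring.
  by rewrite w1 -densityW Wz; lra.
(* [Jensen] says that z^6 is at most the average of [m i * zeta i]; summing [bound] then lets z^5
   cancel. *)
have : z ^+ 5 * dotv (velocity W) e <=
    \sum_i w i * (m i * (3 / 4 * L - zeta i)).
  by rewrite -Wz momW; apply: ler_sum => i _; rewrite ler_wpM2l.
have -> : \sum_i w i * (m i * (3 / 4 * L - zeta i)) =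
    3 / 4 * L * z ^+ 5 - \sum_i w i * (m i * zeta i).
  by rewrite -Wz densityW big_distrr -sumrB; apply: eq_bigr => i _ /=; ring.
move=> h; rewrite -(ler_pM2l (exprn_gt0 5 z0)).
have z6 : z ^+ 6 = z * z ^+ 5 by rewrite exprS.
rewrite z6 in Jensen; lra.
Qed.

(** Without its kinetic part the energy gives p <= 2/5 of it, and each split state has energy at
    most 31/40 L^2 times its density. *)
Let pressureW_le : pressure W <= 31 / 100 * L ^+ 2 * density W.
Proof.
rewrite -(ler_pM2l k0).
apply: (@le_trans _ _ (2 / 5 * (k * energy W))).
  rewrite pressureE mulrCA ler_pM2l// ler_pM2l// gerBl.
  by rewrite !mulr_ge0 ?dotvv_ge0 ?ler0n ?invr_ge0 ?(ltW densityW_gt0).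
have -> : k * (31 / 100 * L ^+ 2 * density W) =
    2 / 5 * (31 / 40 * L ^+ 2 * (k * density W)) by field.
rewrite ler_pM2l// densityW /W energy_sum !big_distrr; apply: ler_sum => i _ /=.
rewrite mulrCA [leRHS]mulrCA ler_wpM2l// energy_split.
have /andP[ai _] := a_bounds i.
have c0 := sound_speed_gt0 (aU i).
have := interior_energy_bound L0 (speed_ge0 i) c0 (UL i) ai.
have /andP[un _] := dotv_unit_le (velocity (U i)) (n1 i).
have y5 := exprn_gt0 5 (y0 i).
move=> /(ler_wpM2l (ltW y5)) h.
rewrite /m mulrCA; apply: le_trans h.
rewrite -/(a i) mulrBr.
have -> : k * (energy (U i) * a i) =
   y i ^+ 5 * (25 / 14 * sound_speed (U i) ^+ 2 +
     1 / 2 * norm2 (velocity (U i)) ^+ 2) * a i.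
  have -> : energy (U i) = 5 / 2 * pressure (U i) + 1 / 2 * density (U i)
     * norm2 (velocity (U i)) ^+ 2 by rewrite sqr_norm2 pressureE; field.
  transitivity ((5 / 2 * (k * pressure (U i)) + 1 / 2 * (k * density (U i))
     * norm2 (velocity (U i)) ^+ 2) * a i); first by field.
  by rewrite Pc; case: (yU i) => _ -> _; field.
rewrite (mulrDr (y i ^+ 5) (_ * a i)) [y i ^+ 5 * (_ * a i)]mulrA lerD2l.
rewrite [k * _]mulrA Pc dotvZr.
rewrite -subr_ge0.
set c := sound_speed (U i); set d := dotv (velocity (U i)) (n i) in un *.
set x := norm2 _ in un *.
have -> : y i ^+ 5 * (5 / 21 * (c ^+ 2 * (x / L))) -
    - (5 / 7 * c ^+ 2 * y i ^+ 5 * ((3 * L)^-1 * d)) =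
    y i ^+ 5 * (5 / 21 * (c ^+ 2 / L)) * (x + d) by field; rewrite gt_eqF.
rewrite mulr_ge0//; last by lra.
rewrite mulr_ge0 ?(ltW y5)// mulr_ge0 ?divr_ge0 ?ler0n ?sqr_ge0//.
by rewrite ltW.
Qed.

(** There is no circularity: [velocityW_le] uses only the density of [W], and supplies the condition
    z <= 3 L - b.n that [mixture] needs before the pressure of [W] is known to lie above the
    isentrope. *)
Lemma interior_average : exists2 z, above_isentrope k z W &
  (forall e, dotv e e = 1 -> dotv (velocity W) e + z <= 3 / 4 * L) /\
  pressure W <= 31 / 100 * L ^+ 2 * density W.
Proof.
have [|z z0 Wz] := @root5 _ (k * density W).
  by rewrite mulr_gt0.
exists z; last by split=> // e; exact: velocityW_le.
apply: mixture => //.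
  rewrite /nu; under eq_bigr do rewrite scalerA mulrC -scalerA.
  by rewrite -scaler_sumr wn scaler0.
move=> i; have /andP[_ un] := dotv_unit_le (velocity (U i)) (n1 i).
have := UL i; have c0 := sound_speed_gt0 (aU i); have := speed_ge0 i.
rewrite /char_speed => x0 xc.
have cD : sound_speed (U i) <= 3 * L - dotv (velocity (U i)) (n i) by lra.
apply: production_ge0 => //.
- by rewrite mulr_gt0.
- by apply: lt_le_trans cD.
- rewrite (above_sound (aU i) (yU i)) -mulrA ler_pM2l//.
  rewrite ler_pM2r ?exprn_gt0// ler_sqr// nnegrE ltW//.
  by apply: lt_le_trans cD.
- by move=> _ _; have := velocityW_le z0 Wz (n1 i); lra.
Qed.

End InteriorAverage.

(** * Pairing with an exterior trace *)

Lemma ler_root5 (R : realFieldType) (x y : R) :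
  0 <= y -> x ^+ 5 <= y ^+ 5 -> x <= y.
Proof.
move=> y0; have [x0|x0 _] := leP 0 x; first by rewrite ler_pXn2r// nnegrE.
exact: le_trans (ltW x0) y0.
Qed.

(** [l], [r], [v] are the normal velocities of W, U- and their pair average, [yl], [yr], [z] the
    isentropic sound speeds. Adding the bounds on [l] gives yl <= 3/4 L, so z + v <= (l + yl) + yl/7
    + 0.138 L < L. *)
Lemma right_subsonic (R : realFieldType) (L l r v z yl yr Pl Pr : R) :
  0 < L -> 0 < z -> 0 < yl -> 0 < yr -> 0 < Pl -> 0 < Pr ->
  - l + yl <= 3 / 4 * L -> l + yl <= 3 / 4 * L ->
  Pl <= 31 / 100 * L ^+ 2 * yl ^+ 5 ->
  - L <= r -> r < L ->
  4 * L * z ^+ 5 = (3 * L + l) * yl ^+ 5 + (L - r) * yr ^+ 5 ->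
  4 * L * z ^+ 5 * v =
    (3 * L + l) * yl ^+ 5 * l + Pl + (L - r) * yr ^+ 5 * r - Pr ->
  yr <= z -> r < v -> z <= L - v.
Proof.
move=> L0 z0 yl0 yr0 Pl0 Pr0 l_lo l_hi Pl_le r_lo r_hi mass balance yz rv.
have yz5 : yr ^+ 5 <= z ^+ 5 by rewrite ler_pXn2r// nnegrE ltW.
(* The mass balance with yr <= z and -L <= r yields z^5 <= 15/8 yl^5, and 15/8 <= (8/7)^5. *)
have zl : z <= 8 / 7 * yl.
  apply: ler_root5; first by rewrite mulr_ge0 ?divr_ge0 ?ler0n// ltW.
  rewrite -(@ler_pM2l _ (2 * L)) ?mulr_gt0//.
  have := exprn_gt0 5 yl0; have := exprn_gt0 5 z0.
  rewrite exprMn; have : 15 / 8 <= (8 / 7 : R) ^+ 5.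
    have h : 13 / 10 <= (8 / 7 : R) ^+ 2 by rewrite expr2; lra.
    have := ler_pM (_ : 0 <= 13 / 10) (_ : 0 <= 13 / 10) h h; rewrite -exprD.
    by rewrite divr_ge0 ?ler0n// exprSr => /(_ isT isT); lra.
  move: ((8 / 7) ^+ 5) => C C0.
  move: yz5 mass; move: (z ^+ 5) (yl ^+ 5) (yr ^+ 5) => Z A B BZ e Z0 A0.
  have h1 : (L - r) * B <= (L - r) * Z by rewrite ler_wpM2l// subr_ge0 ltW.
  have h2 : 0 <= (r + L) * Z by apply: mulr_ge0 (ltW Z0); lra.
  have h3 : 0 <= (3 / 4 * L - l) * A. apply: mulr_ge0 (ltW A0). lra.
  have h4 : 15 / 8 * (L * A) <= C * (L * A).
    by rewrite ler_wpM2r// mulr_ge0 ?ltW.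
  lra.
(* Relative to [v], the momentum balance makes the left state gain at most [Pl], since r < v and 0 <
   Pr. *)
have vl : (3 * L + l) * (v - l) <= 31 / 100 * L ^+ 2.
  rewrite -(ler_pM2r (exprn_gt0 5 yl0)); apply: le_trans Pl_le.
  have : 0 <= (L - r) * yr ^+ 5 * (v - r).
    by rewrite !mulr_ge0 ?exprn_ge0 ?subr_ge0 // ltW.
  move: balance; rewrite mass; lra.
have : v - l <= 138 / 1000 * L.
  have [vl0|/ltW vl0] := leP (v - l) 0; first by apply: (le_trans vl0); lra.
  rewrite -(@ler_pM2l _ (9 / 4 * L)) ?mulr_gt0//.
  have : 0 <= (3 * L + l - 9 / 4 * L) * (v - l) by rewrite mulr_ge0//; lra.
  have := exprn_gt0 2 L0; lra.
lra.
Qed.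

(** The direction at W is reversed and its speed is 3 L, which leaves room for crude bounds: z <= 2
    L and v >= -L. *)
Lemma left_subsonic (R : realFieldType) (c L l r v z yl yr Pl Pr : R) :
  0 < L -> 0 < z -> 0 < yl -> 0 < yr -> 0 < Pl -> 0 < Pr ->
  - l + yl <= 3 / 4 * L -> l + yl <= 3 / 4 * L ->
  - L <= r -> r < L ->
  4 * L * z ^+ 5 = (3 * L + l) * yl ^+ 5 + (L - r) * yr ^+ 5 ->
  4 * L * z ^+ 5 * v =
    (3 * L + l) * yl ^+ 5 * l + Pl + (L - r) * yr ^+ 5 * r - Pr ->
  0 < c -> c <= L - r -> c <= L + r -> yr <= c ->
  7 * Pr = 5 * c ^+ 2 * yr ^+ 5 -> yl <= z -> v < l -> z <= 3 * L + v.
Proof.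
move=> L0 z0 yl0 yr0 Pl0 Pr0 l_lo l_hi r_lo r_hi mass balance.
move=> c0 cr cr' yc Prc yz vl.
have yz5 : yl ^+ 5 <= z ^+ 5 by rewrite ler_pXn2r// nnegrE ltW.
have z2 : z <= 2 * L.
  apply: ler_root5; first by rewrite mulr_ge0// ltW.
  have y5 : yr ^+ 5 <= L ^+ 5.
    by rewrite ler_pXn2r// ?nnegrE ?(ltW yr0) ?(ltW L0)//; lra.
  have Lz : 0 < L / 4 by rewrite divr_gt0.
  rewrite -(ler_pM2l Lz) exprMn.
  have h1 : (L - r) * yr ^+ 5 <= (2 * L) * L ^+ 5.
    by apply: ler_pM => //; rewrite ?exprn_ge0 ?(ltW yr0)//; lra.
  have h2 : (3 * L + l) * yl ^+ 5 <= (15 / 4 * L) * z ^+ 5.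
    by apply: ler_pM => //; rewrite ?exprn_ge0 ?(ltW yl0)//; lra.
  have := mulr_gt0 L0 (exprn_gt0 5 L0); lra.
(* The right state loses at most [Pr], that is 5/7 c^2 yr^5, and c^2 <= (L - r) (L + r). *)
have vL : - (5 / 7) * (L + r) <= v - r.
  have A0 : 0 < (L - r) * yr ^+ 5 by rewrite mulr_gt0 ?exprn_gt0//; lra.
  rewrite -(ler_pM2l A0).
  have h1 : 0 <= (3 * L + l) * yl ^+ 5 * (l - v).
    by rewrite !mulr_ge0 ?exprn_ge0 ?(ltW yl0)//; lra.
  have h2 : c ^+ 2 <= (L - r) * (L + r) by rewrite expr2 ler_pM// ltW.
  have := ler_wpM2r (exprn_ge0 5 (ltW yr0)) h2.
  move: balance Prc; rewrite mass; lra.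
lra.
Qed.

(** The weights 3/4 and 1/4 cancel the directions -n/(3 L) and n/L, so [mixture] applies to the two
    states. *)
Lemma pair_average (R : realType) (N : nat) (k L zl y : R) (n : 'rV[R]_N)
    (W U : state R N) :
  0 < k -> 0 < L -> dotv n n = 1 -> above_isentrope k zl W -> 0 < pressure W ->
  (forall e, dotv e e = 1 -> dotv (velocity W) e + zl <= 3 / 4 * L) ->
  pressure W <= 31 / 100 * L ^+ 2 * density W ->
  admissible U -> above_isentrope k y U -> char_speed U <= L ->
  exists z, above_isentrope k z
    ((3 / 4) *: (W - flux W ((3 * L)^-1 *: (- n)))
     + (1 / 4) *: (U - flux U (L^-1 *: n))).
Proof.
move=> k0 L0 n1 Wz pW Wv Wp aU Uy UL.
have nn1 : dotv (- n) (- n) = 1 by rewrite dotvNl dotvNr opprK.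
pose w (b : bool) : R := if b then 3 / 4 else 1 / 4.
pose nu b := if b then (3 * L)^-1 *: (- n) else L^-1 *: n.
pose S b := if b then W else U.
set V := _ + _.
have VE : V = \sum_b w b *: (S b - flux (S b) (nu b)) by rewrite big_bool.
set l := dotv (velocity W) n; set r := dotv (velocity U) n.
have l_hi : l + zl <= 3 / 4 * L by exact: Wv.
have l_lo : - l + zl <= 3 / 4 * L by rewrite -dotvNr; exact: Wv.
have W0 := above_density_gt0 k0 Wz; have [U0 pU] := aU.
have c0 := sound_speed_gt0 aU; have yc := above_le_sound k0 aU Uy.
have Pc := above_sound aU Uy.
have [[zl0 Wd WP] [y0 Ud UP]] := (Wz, Uy).
have [cr cr'] : sound_speed U <= L - r /\ sound_speed U <= L + r.
  have /andP[] := dotv_unit_le (velocity U) n1; rewrite -/r.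
  by move: UL; rewrite /char_speed; move: (norm2 _) => x *; split; lra.
have massV : 4 * L * (k * density V) = (3 * L + l) * zl ^+ 5 + (L - r) * y ^+ 5.
  have -> : k * density V = \sum_b w b *
      (k * density (S b) * (1 - dotv (velocity (S b)) (nu b))).
    rewrite VE density_sum big_distrr; apply: eq_bigr => b _ /=.
    by rewrite density_split; ring.
  rewrite big_bool /=.
  rewrite (dotvZr _ (- n)) (dotvZr _ n) dotvNr -/l -/r -Wd -Ud.
  by field; rewrite gt_eqF.
have L4 : 0 < 4 * L by rewrite mulr_gt0.
have dV : 0 < density V.
  rewrite -(pmulr_rgt0 _ k0) -(pmulr_rgt0 _ L4) massV.
  by rewrite addr_gt0// mulr_gt0 ?exprn_gt0//; lra.
have [|z z0 Vz] := @root5 _ (k * density V); first by rewrite mulr_gt0.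
exists z; rewrite Vz in massV; set v := dotv (velocity V) n.
have balance : 4 * L * z ^+ 5 * v =
    (3 * L + l) * zl ^+ 5 * l + k * pressure W + (L - r) * y ^+ 5 * r
    - k * pressure U.
  have -> : 4 * L * z ^+ 5 * v = 4 * L * k * dotv (momentum V) n.
    by rewrite momentumE ?gt_eqF// (dotvZl _ (velocity V)) -/v -Vz; ring.
  have -> : dotv (momentum V) n = \sum_b w b * (density (S b)
      * (1 - dotv (velocity (S b)) (nu b)) * dotv (velocity (S b)) n
      - pressure (S b) * dotv (nu b) n).
    rewrite VE momentum_sum dotv_suml; apply: eq_bigr => b _ /=.
    by rewrite dotvZl momentum_split//; case: b; rewrite gt_eqF.
  rewrite big_bool /=.
  rewrite (dotvZr _ n) (dotvZr _ (- n)) (dotvZl _ n) (dotvZl _ (- n)).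
  rewrite !dotvNr !dotvNl n1 -/l -/r.
  by rewrite -Wd -Ud; field; rewrite gt_eqF.
have Pl_le : k * pressure W <= 31 / 100 * L ^+ 2 * zl ^+ 5.
  by rewrite -Wd; have := ler_wpM2l (ltW k0) Wp; lra.
have le_z x P : 0 < x -> 5 / 7 * x ^+ 7 <= P -> P < 5 / 7 * z ^+ 7 -> x <= z.
  move=> x0 xP Pz; rewrite -(@ler_pXn2r _ 7)// ?nnegrE ?ltW//; lra.
have [r_lo r_hi] : - L <= r /\ r < L by split; lra.
have [PW0 PU0] := (mulr_gt0 k0 pW, mulr_gt0 k0 pU).
have y5 := exprn_gt0 5 zl0.
rewrite VE; apply: (@mixture _ _ _ _ _ w nu S (fun b => if b then zl else y));
  rewrite -?VE //.
- by case; rewrite /w divr_ge0 ?ler0n.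
- by rewrite big_bool /w /=; field.
- rewrite big_bool /= scalerN scalerN scalerA scalerA -scaleNr -scalerDl.
  by rewrite (_ : _ + _ = 0) ?scale0r//; field; rewrite gt_eqF.
- by case.
case; apply: production_ge0; rewrite ?mulr_gt0// ?dotvNr ?opprK -/l -/r.
- lra.
- apply: (@le_trans _ _ (7 * (31 / 100 * L ^+ 2 * zl ^+ 5))).
    by rewrite ler_pM2l.
  have h : (9 / 4 * L) ^+ 2 <= (3 * L + l) ^+ 2.
    by rewrite ler_sqr ?nnegrE//; lra.
  have := ler_wpM2r (ltW y5) h; have := mulr_gt0 (exprn_gt0 2 L0) y5; lra.
- move=> Pz; rewrite -/v ltrN2 => vl.
  exact: (left_subsonic L0 z0 zl0 y0 PW0 PU0 l_lo l_hi r_lo r_hi massV balance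
    c0 cr cr' yc Pc (le_z _ _ zl0 WP Pz) vl).
- lra.
- rewrite Pc -mulrA ler_pM2l// ler_pM2r ?exprn_gt0// ler_sqr// nnegrE ltW//.
  lra.
- move=> Pz rv.
  exact: (right_subsonic L0 z0 zl0 y0 PW0 PU0 l_lo l_hi Pl_le r_lo r_hi massV
    balance (le_z _ _ y0 UP Pz) rv).
Qed.

(** * The Lax-Friedrichs step as a convex combination *)

Lemma convex_above (R : realType) (N : nat) (J : finType) (k : R)
    (c y : J -> R) (X : J -> state R N) :
  0 < k -> (forall j, 0 <= c j) -> \sum_j c j = 1 ->
  (forall j, above_isentrope k (y j) (X j)) ->
  exists z, above_isentrope k z (\sum_j c j *: X j).
Proof.
move=> k0 c0 c1 Xy.
have XE : \sum_j c j *: X j = \sum_j c j *: (X j - flux (X j) 0).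
  by apply: eq_bigr => j _; rewrite flux0 subr0.
have d0 : 0 < density (\sum_j c j *: X j).
  by rewrite density_sum convex_gt0// => j; exact: above_density_gt0 (Xy j).
have [|z z0 Xz] := @root5 _ (k * density (\sum_j c j *: X j)).
  by rewrite mulr_gt0.
(* With zero directions the production is kinetic plus relative internal energy. *)
exists z; rewrite XE in Xz *; apply: (mixture (nu := fun=> 0)) => //.
  by rewrite big1// => j _; rewrite scaler0.
move=> j; rewrite /production !dotvr0 subr0 mul1r mulr0 subr0.
case: (Xy j) => y0 _ yP; apply: addr_ge0.
  by rewrite divr_ge0 ?ler0n// mulr_ge0 ?dotvv_ge0// exprn_ge0 ?ltW.
exact: rel_energy_ge0 (ltW y0) (ltW z0) yP.
Qed.

(** [A], [D] are the two traces and [B], [C] their fluxes. The weight 3/2 g on [A] allows the slower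
    splitting at 3 L, as 3/2 g / (3 L) is the flux coefficient g / (2 L). *)
Lemma llf_split (R : realType) (n : nat) (t g L : R) (A B C D : 'rV[R]_n) :
  L != 0 ->
  t *: A - (g / L) *: (2^-1 *: (B + C) - (2^-1 * L) *: (D - A)) =
  (t - 2 * g) *: A + ((3 / 2 * g) *: (A - (3 * L)^-1 *: B)
    + (1 / 2 * g) *: (D - L^-1 *: C)).
Proof. by move=> L0; apply/rowP => j; rewrite !mxE; field. Qed.

(** The flux of [W] is isolated with a coefficient proportional to [g], so that it disappears in the
    sum over the faces. *)
Lemma pair_split (R : realType) (n : nat) (g L : R) (W F X : 'rV[R]_n) :
  L != 0 ->
  (2 * g) *: ((3 / 4) *: (W - (3 * L)^-1 *: (- F)) + (1 / 4) *: X) =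
  (3 / 2 * g) *: W + (2 * L)^-1 *: (g *: F) + (1 / 2 * g) *: X.
Proof. by move=> L0; apply/rowP => j; rewrite !mxE; field. Qed.

Lemma llf_step_above (R : realType) (N : nat) (I T : finType) (k L : R)
    (a : I -> R) (theta g : T -> R) (n : T -> 'rV[R]_N)
    (V : I -> state R N) (Up Um : T -> state R N) :
  0 < k -> (forall i, 0 <= a i) -> (forall t, 0 < g t) ->
  (forall t, 2 * g t <= theta t) ->
  \sum_i a i + \sum_t theta t = 1 ->
  (forall t, dotv (n t) (n t) = 1) -> \sum_t g t *: n t = 0 ->
  (forall i, exists y, above_isentrope k y (V i)) ->
  (forall t, exists y, above_isentrope k y (Up t)) ->
  (forall t, exists y, above_isentrope k y (Um t)) ->
  (forall t, admissible (Up t)) -> (forall t, admissible (Um t)) ->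
  (forall t, 8 / 5 * char_speed (Up t) <= L) ->
  (forall t, char_speed (Um t) <= L) ->
  exists z, above_isentrope k z (\sum_i a i *: V i +
    \sum_t (theta t *: Up t - (g t / L) *: llf_flux L (Up t) (Um t) (n t))).
Proof.
move=> k0 a0 g0 gtheta a1 n1 gn /choice[yV Vy] /choice[yp Upy] /choice[ym Umy].
move=> aUp aUm UpL UmL.
(* Without face points nothing makes [L] positive, but the flux sum is empty and convexity
   suffices. *)
case: (pickP (fun _ : T => true)) => [t0 _|T0]; last first.
  have sT0 (M : nmodType) (F : T -> M) : \sum_t F t = 0.
    by apply: big1 => t; have := T0 t.
  rewrite sT0 addr0; move: a1; rewrite sT0 addr0 => a1.
  exact: convex_above Vy.
have L0 : 0 < L.
  apply: lt_le_trans (UmL t0); rewrite /char_speed.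
  by rewrite ltr_wpDl ?norm2_ge0 ?sound_speed_gt0.
have Ln0 : L != 0 by rewrite gt_eqF.
pose G := \sum_t g t.
have G0 : 0 < G.
  rewrite /G (bigD1 t0)//= ltr_pwDl//.
  by apply: sumr_ge0 => t _; exact: ltW.
pose w t := g t / G.
pose W := \sum_t w t *: (Up t - flux (Up t) ((3 * L)^-1 *: n t)).
have GW : G *: W = \sum_t g t *: (Up t - (3 * L)^-1 *: flux (Up t) (n t)).
  rewrite scaler_sumr; apply: eq_bigr => t _.
  by rewrite scalerA fluxZ /w mulrC divfK// gt_eqF.
have [zW Wz [Wv Wp]] : exists2 z, above_isentrope k z W &
  (forall e, dotv e e = 1 -> dotv (velocity W) e + z <= 3 / 4 * L) /\
  pressure W <= 31 / 100 * L ^+ 2 * density W.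
  apply: (@interior_average _ _ _ k L w yp n Up) => //.
  - by move=> t; rewrite divr_ge0// ltW.
  - by rewrite -mulr_suml divff// gt_eqF.
  - under eq_bigr do rewrite /w mulrC -scalerA.
    by rewrite -scaler_sumr gn scaler0.
have pW : 0 < pressure W.
  rewrite -(pmulr_rgt0 _ k0); case: Wz => z0 _; apply: lt_le_trans.
  by rewrite mulr_gt0 ?exprn_gt0 ?divr_gt0 ?ltr0n.
pose P t := (3 / 4) *: (W - flux W ((3 * L)^-1 *: (- n t)))
  + (1 / 4) *: (Um t - flux (Um t) (L^-1 *: n t)).
have /choice[yP Py] t : exists z, above_isentrope k z (P t).
  exact: (pair_average k0 L0 (n1 t) Wz pW Wv Wp (aUm t) (Umy t) (UmL t)).
have fluxN U (e : 'rV[R]_N) : flux U (- e) = - flux U e.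
  by rewrite -scaleN1r fluxZ scaleN1r.
have gF : \sum_t g t *: flux W (n t) = 0.
  transitivity (flux W (\sum_t g t *: n t)); last by rewrite gn flux0.
  by rewrite flux_sum; apply: eq_bigr => t _; rewrite fluxZ.
(* The total weight 3/2 G of [W] gives back the split interior traces it averages, and its fluxes
   cancel by [gF]. *)
have sumP : \sum_t (2 * g t) *: P t =
    \sum_t ((3 / 2 * g t) *: (Up t - (3 * L)^-1 *: flux (Up t) (n t))
      + (1 / 2 * g t) *: (Um t - L^-1 *: flux (Um t) (n t))).
  under eq_bigr => t _ do rewrite /P fluxZ fluxN fluxZ pair_split//.
  rewrite !big_split /=; congr (_ + _).
  rewrite -scaler_suml -mulr_sumr -scalerA GW scaler_sumr.
  rewrite -[X in _ + X]scaler_sumr gF scaler0 addr0.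
  by apply: eq_bigr => t _; rewrite scalerA.
have -> : \sum_i a i *: V i +
    \sum_t (theta t *: Up t - (g t / L) *: llf_flux L (Up t) (Um t) (n t)) =
  \sum_(j : I + (T + T)) (match j with inl i => a i
     | inr (inl t) => theta t - 2 * g t | inr (inr t) => 2 * g t end) *:
   (match j with inl i => V i | inr (inl t) => Up t | inr (inr t) => P t end).
  rewrite !big_sumType /= sumP; congr (_ + _).
  rewrite -big_split; apply: eq_bigr => t _.
  by rewrite /llf_flux llf_split.
apply: (@convex_above _ _ _ k _ (fun j => match j with inl i => yV i
     | inr (inl t) => yp t | inr (inr t) => yP t end)) => //.
- case=> [i|[t|t]]//; first by rewrite subr_ge0.
  by rewrite mulr_ge0// ltW.
- rewrite !big_sumType /= -big_split /= -[RHS]a1; congr (_ + _).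
  by apply: eq_bigr => t _; rewrite subrK.
- by case=> [i|[t|t]].
Qed.

(** * Entropy levels as isentropes *)

Definition isentrope_scale (R : realType) (s s0 : R) : R :=
  expR (5 / 2 * (s - s0 - ln (5 / 7))).

(** The scale solves 5/7 (k rho)^(7/5) = k p at entropy [s]: there p / rho^(7/5) = exp (s - s0),
    hence ln k = 5/2 (s - s0 - ln (5/7)). *)
Lemma ln_above (R : realType) (s s0 rho p y : R)
    (k := isentrope_scale s s0) :
  0 < rho -> 0 < p -> 0 < y -> k * rho = y ^+ 5 ->
  (5 / 7 * y ^+ 7 <= k * p) = (s <= ln p - 14 / 10 * ln rho + s0).
Proof.
move=> rho0 p0 y0 rhoE.
have k0 : 0 < k by exact: expR_gt0.
have c0 : (0 : R) < 5 / 7 by rewrite divr_gt0 ?ltr0n.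
have lnk : ln k = 5 / 2 * (s - s0 - ln (5 / 7)) by rewrite expRK.
have : ln k + ln rho = 5 * ln y.
  by rewrite -lnM ?posrE// rhoE lnXn// mulr_natl.
have e1 : ln (5 / 7 * y ^+ 7) = ln (5 / 7) + 7 * ln y.
  by rewrite lnM ?posrE ?exprn_gt0// lnXn// (mulr_natl (ln y)).
have e2 : ln (k * p) = ln k + ln p by rewrite lnM ?posrE.
rewrite -ler_ln ?posrE ?mulr_gt0 ?exprn_gt0// e1 e2 lnk => e.
by apply/idP/idP; lra.
Qed.

Lemma above_entropy (R : realType) (N : nat) (s s0 : R) (U : state R N) :
  admissible U -> s <= entropy s0 U ->
  exists y, above_isentrope (isentrope_scale s s0) y U.
Proof.
move=> [rho0 p0] sU.
have [|y y0 Uy] := @root5 _ (isentrope_scale s s0 * density U).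
  by rewrite mulr_gt0 ?expR_gt0.
by exists y; split=> //; rewrite (ln_above rho0).
Qed.

Lemma entropy_of_above (R : realType) (N : nat) (s s0 : R) (U : state R N) y :
  above_isentrope (isentrope_scale s s0) y U ->
  admissible U /\ s <= entropy s0 U.
Proof.
have k0 : 0 < isentrope_scale s s0 by exact: expR_gt0.
move=> Uy; have rho0 := above_density_gt0 k0 Uy.
case: Uy => y0 yd yP.
have p0 : 0 < pressure U.
  rewrite -(pmulr_rgt0 _ k0); apply: lt_le_trans yP.
  by rewrite mulr_gt0 ?exprn_gt0 ?divr_gt0 ?ltr0n.
by split=> //; rewrite /entropy -(ln_above rho0 p0 y0 yd).
Qed.

(** * Interpolation and quadrature *)

Lemma peval_sum (R : realType) (N : nat) (I : finType) (a : I -> R)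
    (p : I -> mpoly N R) r :
  peval (\sum_i a i *: p i) r = \sum_i a i * peval (p i) r.
Proof.
rewrite /peval; elim/big_rec2: _ => [|i x q _ <-]; first exact: meval0.
by rewrite mevalD mevalZ.
Qed.

Section Interpolation.
Variables (R : realType) (N : nat) (E : element R N) (Q : quadrature E).
Variables (Np : nat) (b : 'I_Np -> mpoly N R) (sel : 'I_Np -> 'I_(nvq Q)).
Variable (phi : 'I_(nvq Q) -> mpoly N R).
Hypothesis phiP : lagrange_basis b sel phi.

(** [d] holds the coefficients of [p] minus its interpolant, which vanishes at the selected points;
    the invertible interpolation matrix forces [d = 0]. *)
Lemma lagrange_interpolation p r : in_span b p ->
  peval p r = \sum_v peval p (vpt v) * peval (phi v) r.
Proof.
move=> [a ->]; set p' := \sum_j a j *: b j.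
have /choice[c phiE] i : in_span b (phi (sel i)) by exact: (phi_span phiP).
pose x i := vpt (sel i).
pose M := \matrix_(i, j) peval (b j) (x i).
pose d := \col_j (a j - \sum_i peval p' (x i) * c i j).
have : M *m d = 0.
  apply/colP => l; rewrite !mxE.
  under eq_bigr do rewrite !mxE mulrBr mulrC.
  rewrite sumrB -peval_sum -/p'; apply/eqP; rewrite subr_eq0; apply/eqP.
  transitivity (\sum_i peval p' (x i) * peval (phi (sel i)) (x l)).
    rewrite (bigD1 l)//= (phi_sel phiP) eqxx mulr1 big1 ?addr0// => i il.
    by rewrite (phi_sel phiP) (negbTE il) mulr0.
  under [RHS]eq_bigr do rewrite big_distrr.
  rewrite exchange_big; apply: eq_bigr => i _ /=.
  rewrite phiE peval_sum big_distrr; apply: eq_bigr => j _ /=.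
  by rewrite mulrA mulrC.
move/(congr1 (mulmx (invmx M))); rewrite mulmxA mulVmx ?(interp_unit phiP)//.
rewrite mul1mx mulmx0 => d0.
have aE j : a j = \sum_i peval p' (x i) * c i j.
  have := congr1 (fun A => fun_of_matrix A j 0) d0; rewrite !mxE => /eqP.
  by rewrite subr_eq0 => /eqP.
rewrite peval_sum; under eq_bigr do rewrite aE big_distrl.
rewrite exchange_big /=.
rewrite (bigID (mem (codom sel))) /= [X in _ + X]big1 ?addr0; last first.
  by move=> v vsel; rewrite (phi_out phiP vsel) /peval meval0 mulr0.
rewrite -big_uniq /=; last first.
  by rewrite map_inj_uniq ?enum_uniq//; exact: sel_inj phiP.
rewrite big_image /=; apply: eq_bigr => i _.
rewrite phiE peval_sum big_distrr; apply: eq_bigr => j _ /=.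
by rewrite mulrA.
Qed.

Lemma sol_interpolation (U : 'I_(1 + (N + 1)) -> mpoly N R) r :
  (forall i, in_span b (U i)) ->
  sol_at U r = \sum_v peval (phi v) r *: sol_at U (vpt v).
Proof.
move=> Ub; apply/rowP => i; rewrite mxE summxE.
rewrite lagrange_interpolation//; apply: eq_bigr => v _.
by rewrite !mxE mulrC.
Qed.

Lemma partition_of_unity r : space_basis b -> \sum_v peval (phi v) r = 1.
Proof.
case=> _ b1; have := lagrange_interpolation r b1.
rewrite /peval meval1 => ->; apply: eq_bigr => v _.
by rewrite meval1 mul1r.
Qed.

End Interpolation.

(** Origin of the constant 8/5: for gamma = 7/5 the second term of [tau] is exactly the square root
    of 64/25. *)
Lemma tau_ge (R : realType) (N : nat) : 8 / 5 <= tau R N.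
Proof.
rewrite /tau le_max; apply/orP; right.
have -> : 2 + gamma R * (gamma R - 1) = (8 / 5) ^+ 2 by rewrite /gamma; field.
by rewrite sqrtr_sqr ler_norm.
Qed.

Lemma char_speed_ge0 (R : realType) (N : nat) (U : state R N) :
  0 <= char_speed U.
Proof. by rewrite addr_ge0 ?sqrtr_ge0. Qed.

Lemma lambda_star_ge (R : realType) (N : nat) (E : element R N)
    (Q : quadrature E) (U : 'I_(1 + (N + 1)) -> mpoly N R)
    (k : 'I_(nfaces E)) (q : 'I_(nfq Q k)) :
  8 / 5 * char_speed (sol_at U (fref q)) <= lambda_star Q U.
Proof.
apply: ler_pM (tau_ge R N) _; rewrite ?char_speed_ge0 ?divr_ge0 ?ler0n//.
apply: le_trans (le_bigmax _ _ k).
exact: (le_bigmax _ (fun q => char_speed (sol_at U (fref q))) q).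
Qed.

Lemma fnormal_unit (R : realType) (N : nat) (E : element R N)
    (Q : quadrature E) (k : 'I_(nfaces E)) (q : 'I_(nfq Q k)) :
  zeta q != 0 -> dotv (fnormal q) (fnormal q) = 1.
Proof.
rewrite /zeta !mulf_eq0 !negb_or => /andP[/andP[n0 _] _].
rewrite /fnormal /face_normal dotvZl dotvZr -sqr_norm2.
by rewrite mulrA -expr2 -exprMn mulVf ?expr1n.
Qed.

(** * The Euler step in terms of volume and face values *)

Section EulerStep.
Variables (R : realType) (N : nat) (E : element R N) (Q : quadrature E).
Variables (Np : nat) (b : 'I_Np -> mpoly N R) (sel : 'I_Np -> 'I_(nvq Q)).
Variable (phi : 'I_(nvq Q) -> mpoly N R).
Variable U : 'I_(1 + (N + 1)) -> mpoly N R.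
Variable Uext : 'I_(nfaces E) -> 'rV[R]_N.-1 -> state R N.
Variables (dt lambda : R) (theta : forall k : 'I_(nfaces E), 'I_(nfq Q k) -> R).
Hypotheses (Qwf : quadrature_wf Q) (bP : space_basis b).
Hypothesis phiP : lagrange_basis b sel phi.
Hypothesis U_span : forall i, in_span b (U i).

Let T := {k : 'I_(nfaces E) & 'I_(nfq Q k)}.

Lemma face_sum (M : nmodType)
    (F : forall k : 'I_(nfaces E), 'I_(nfq Q k) -> M) :
  \sum_k \sum_q F k q = \sum_(t : T) F (tag t) (tagged t).
Proof.
by rewrite (sig_big_dep xpredT (fun k q => true)).
Qed.

(** Interpolation expresses each interior trace by volume values, so weights [theta] can be moved
    from the volume points to the traces. *)
Lemma cell_average_split :
  cell_average Q U =
  \sum_v theta_vol phi theta v *: sol_at U (vpt v) +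
  \sum_(t : T) theta (tagged t) *: sol_at U (fref (tagged t)).
Proof.
have -> : \sum_(t : T) theta (tagged t) *: sol_at U (fref (tagged t)) =
   \sum_v (\sum_(t : T) theta (tagged t) * peval (phi v) (fref (tagged t)))
     *: sol_at U (vpt v).
  under [RHS]eq_bigr do rewrite scaler_suml.
  rewrite exchange_big; apply: eq_bigr => t _ /=.
  rewrite (sol_interpolation phiP _ U_span) scaler_sumr; apply: eq_bigr => v _.
  by rewrite scalerA.
rewrite -big_split; apply: eq_bigr => v _ /=.
by rewrite /theta_vol face_sum -scalerDl subrK.
Qed.

Lemma weights_sum :
  0 < elt_vol E ->
  \sum_v theta_vol phi theta v + \sum_(t : T) theta (tagged t) = 1.
Proof.
move=> vol0; have -> : \sum_(t : T) theta (tagged t) =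
   \sum_v \sum_(t : T) theta (tagged t) * peval (phi v) (fref (tagged t)).
  rewrite exchange_big; apply: eq_bigr => t _ /=.
  by rewrite -big_distrr /= (partition_of_unity phiP) ?mulr1.
rewrite -big_split /=.
transitivity (\sum_v @vfrac _ _ _ Q v).
  by apply: eq_bigr => v _; rewrite /theta_vol face_sum subrK.
by rewrite /vfrac -big_distrl /= (vol_exact Qwf) divff// gt_eqF.
Qed.

(** dt zeta becomes (dt lambda zeta) / lambda, the form g / L of [llf_step_above]. The hypothesis is
    conditional on a face point because the sign of [lambda] comes from a trace. *)
Lemma euler_step_split : (T -> lambda != 0) ->
  euler_step Q U Uext lambda dt =
  \sum_v theta_vol phi theta v *: sol_at U (vpt v) +
  \sum_(t : T) (theta (tagged t) *: sol_at U (fref (tagged t)) -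
    (dt * lambda * zeta (tagged t) / lambda) *:
    llf_flux lambda (sol_at U (fref (tagged t)))
      (Uext (tag t) (fpt (tagged t))) (fnormal (tagged t))).
Proof.
move=> L0; rewrite /euler_step cell_average_split face_sum sumrB addrA.
congr (_ - _); rewrite scaler_sumr; apply: eq_bigr => t _.
by rewrite scalerA; congr (_ *: _); field; exact: L0.
Qed.

End EulerStep.

Lemma cfl_le (R : realFieldType) (x z th : R) :
  0 < z -> x <= 2^-1 * (th / z) -> 2 * (x * z) <= th.
Proof.
move=> z0; rewrite -(ler_pM2r z0).
have -> : 2^-1 * (th / z) * z = 2^-1 * th by field; rewrite gt_eqF.
lra.
Qed.

Lemma opp_sum_norm_le (R : realDomainType) (I : finType) (f : I -> R) i :
  - (\sum_i `|f i|) <= f i.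
Proof.
apply: (@le_trans _ _ (- `|f i|)); last by rewrite lerNl -normrN ler_norm.
by rewrite lerN2 (bigD1 i)//= lerDl sumr_ge0.
Qed.

(** * Minimum entropy principle for the element average *)

Theorem lemma5 (R : realType) (N : nat) (s0 : R)
  (E : element R N) (Q : quadrature E)
  (Np : nat) (b : 'I_Np -> mpoly N R)
  (sel : 'I_Np -> 'I_(nvq Q)) (phi : 'I_(nvq Q) -> mpoly N R)
  (U : 'I_(1 + (N + 1)) -> mpoly N R)
  (Uext : 'I_(nfaces E) -> 'rV[R]_N.-1 -> state R N)
  (dt lambda : R) (theta : forall k : 'I_(nfaces E), 'I_(nfq Q k) -> R)
  (N_gt0 : (0 < N)%N)
  (Ewf : element_wf E) (Qwf : quadrature_wf Q)
  (bP : space_basis b) (phiP : lagrange_basis b sel phi)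
  (U_span : forall i, in_span b (U i))
  (U_adm : forall W, sol_values U Uext W -> admissible W)
  (dt_gt0 : 0 < dt)
  (lambda_ge_int : forall (k : 'I_(nfaces E)) (q : 'I_(nfq Q k)),
     char_speed (sol_at U (fref q)) <= lambda)
  (lambda_ge_ext : forall (k : 'I_(nfaces E)) (q : 'I_(nfq Q k)),
     char_speed (Uext k (fpt q)) <= lambda)
  (lambda_ge_star : lambda_star Q U <= lambda)
  (theta_gt0 : forall (k : 'I_(nfaces E)) (q : 'I_(nfq Q k)), 0 < theta k q)
  (theta_vol_ge0 : forall v : 'I_(nvq Q), 0 <= theta_vol phi theta v)
  (cfl : forall (k : 'I_(nfaces E)) (q : 'I_(nfq Q k)),
     dt * lambda <= 2^-1 * (theta k q / zeta q)) :
  admissible (euler_step Q U Uext lambda dt) /\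
  (min_entropy s0 U Uext <=
     (entropy s0 (euler_step Q U Uext lambda dt))%:E)%E.
Proof.
pose T := {k : 'I_(nfaces E) & 'I_(nfq Q k)}.
have val_vol v : sol_values U Uext (sol_at U (vpt (q := Q) v)).
  by left; exists (vpt v) => //; exact: (vpt_in Qwf).
have val_int (t : T) : sol_values U Uext (sol_at U (fref (tagged t))).
  left; exists (fref (tagged t)) => //.
  suff: (ref_elt E `\` interior (ref_elt E))%classic (fref (tagged t)) by case.
  rewrite -(elt_bndE Ewf); exists (tag t) => //.
  by exists (fpt (tagged t)) => //; exact: (fpt_in Qwf).
have val_ext (t : T) : sol_values U Uext (Uext (tag t) (fpt (tagged t))).
  right; exists (tag t) => //; exists (fpt (tagged t)) => //.
  exact: (fpt_in Qwf).
have lambda0 (t : T) : 0 < lambda.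
  apply: lt_le_trans (lambda_ge_int (tag t) (tagged t)).
  by rewrite ltr_wpDl ?norm2_ge0// sound_speed_gt0//; exact/U_adm/val_int.
(* A real [s] below the entropies at the quadrature points is enough; this serves both for
   admissibility and for the infimum. *)
have above s : (forall v, s <= entropy s0 (sol_at U (vpt (q := Q) v))) ->
    (forall t : T, s <= entropy s0 (sol_at U (fref (tagged t)))) ->
    (forall t : T, s <= entropy s0 (Uext (tag t) (fpt (tagged t)))) ->
    admissible (euler_step Q U Uext lambda dt) /\
    s <= entropy s0 (euler_step Q U Uext lambda dt).
  move=> s_vol s_int s_ext.
  have [y] : exists y, above_isentrope (isentrope_scale s s0) y
      (euler_step Q U Uext lambda dt); last exact: entropy_of_above.
  rewrite (euler_step_split Uext dt theta phiP U_span); last first.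
    by move=> t; rewrite gt_eqF// (lambda0 t).
  apply: llf_step_above => //.
  - exact: expR_gt0.
  - by move=> t; exact: mulr_gt0 (mulr_gt0 dt_gt0 (lambda0 t)) (zeta_gt0 Qwf _).
  - move=> t; exact: cfl_le (zeta_gt0 Qwf (tagged t)) (cfl _ (tagged t)).
  - exact: (weights_sum _ Qwf bP phiP (elt_vol_gt0 Ewf)).
  - by move=> t; rewrite fnormal_unit// gt_eqF//; exact: (zeta_gt0 Qwf).
  - under eq_bigr do rewrite -scalerA.
    rewrite -scaler_sumr.
    have := normal_exact Qwf; rewrite face_sum => ->; exact: scaler0.
  - by move=> v; apply: above_entropy => //; exact/U_adm/val_vol.
  - by move=> t; apply: above_entropy => //; exact/U_adm/val_int.
  - by move=> t; apply: above_entropy => //; exact/U_adm/val_ext.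
  - by move=> t; exact/U_adm/val_int.
  - by move=> t; exact/U_adm/val_ext.
  - by move=> t; apply: le_trans lambda_ge_star; exact: lambda_star_ge.
have inf_le W : sol_values U Uext W ->
    (min_entropy s0 U Uext <= (entropy s0 W)%:E)%E.
  by move=> UW; apply: ereal_inf_lbound; exists W.
split.
  (* The infimum could be -oo, so admissibility uses a crude finite lower bound of the finitely many
     entropies involved. *)
  pose a v := entropy s0 (sol_at U (vpt (q := Q) v)).
  pose i (t : T) := entropy s0 (sol_at U (fref (tagged t))).
  pose e (t : T) := entropy s0 (Uext (tag t) (fpt (tagged t))).
  pose A := \sum_v `|a v|; pose B := \sum_t `|i t|; pose C := \sum_t `|e t|.
  have [A0 B0 C0] : [/\ 0 <= A, 0 <= B & 0 <= C] by split; exact: sumr_ge0.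
  have [v|t|t|//] := above (- (A + B + C)).
  - apply: le_trans (opp_sum_norm_le a v).
    by rewrite lerN2 -/A -addrA lerDl addr_ge0.
  - apply: le_trans (opp_sum_norm_le i t).
    by rewrite lerN2 -/B addrAC lerDr addr_ge0.
  - apply: le_trans (opp_sum_norm_le e t).
    by rewrite lerN2 -/C lerDr addr_ge0.
move: inf_le; case: (min_entropy s0 U Uext) => [s||] inf_le; last exact: leNye.
  rewrite lee_fin.
  by apply: (above s _ _ _).2 => [v|t|t]; rewrite -lee_fin; exact: inf_le.
(* The infimum is not +oo: a positive volume forces a volume quadrature point, whose entropy is
   finite. *)
have : (0 < nvq Q)%N.
  rewrite lt0n; apply/eqP => Q0.
  have := vol_exact Qwf; have := elt_vol_gt0 Ewf => /[swap] <-.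
  by rewrite big1 ?ltxx// => v; have := ltn_ord v; rewrite {2}Q0.
by move=> v0; have := inf_le _ (val_vol (Ordinal v0)); rewrite leye_eq.
Qed.
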